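(* Let $G$ be a countably infinite discrete amenable group and let $G\curvearrowright X$ be a free action by homeomorphisms on a compact metrizable space. The following are equivalent. (i) The action has URP and comparison. (ii) The action has URP and weak $k$-comparison for some $k\in\mathbb{N}$. (iii) For every finite $K\subset G$ and every $\varepsilon>0$ there is a castle $\{(S_i,V_i)\}_{i=1}^n$ with $(K,\varepsilon)$-invariant shapes such that $\left[X\setminus\bigsqcup_{i=1}^nS_iV_i\right]\prec\sum_{i=1}^n\lfloor\varepsilon|S_i|\rfloor[V_i]$. (iv) The action has the marker property, and for every finite $K\subset G$, every $\varepsilon>0$ and every marker set $U$ there is a castle $\{(S_i,V_i)\}_{i=1}^n$ with $(K,\varepsilon)$-invariant shapes such that $X\setminus\bigsqcup_{i=1}^nS_iV_i\prec U$.
   Context: Invariance and density: a finite set $S\subset G$ is $(K,\varepsilon)$-invariant if $\left|\bigcap_{g\in K}gS\right|>(1-\varepsilon)|S|$. For $A\subset X$, $\overline{D}(A)=\inf_F\sup_{x\in X}\frac{|A\cap Fx|}{|F|}$ and $\underline{D}(A)=\sup_F\inf_{x\in X}\frac{|A\cap Fx|}{|F|}$, over nonempty finite $F\subset G$. Markers: a set $U\subset X$ is $L$-free (for finite $L\subset G$) if the sets $gU$, $g\in L$, are pairwise disjoint. A marker set is an open set $U$ with $\bigcup_{g\in G}gU=X$. The marker property: for every finite $L\subset G$ there is an $L$-free marker set. Castles: a tower is a pair $(S,V)$ with $S\subset G$ finite (the shape) and $V\subset X$ open and $S$-free; $SV=\bigcup_{g\in S}gV$. A castle is a finite collection of towers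 $\{(S_i,V_i)\}_{i=1}^n$ with the sets $S_iV_i$ pairwise disjoint. URP: for every finite $K\subset G$ and $\varepsilon>0$ there is a castle with $(K,\varepsilon)$-invariant shapes and $\overline{D}\left(X\setminus\bigsqcup_iS_iV_i\right)<\varepsilon$. Subequivalence: let $A_1,\dots,A_p\subset X$ be closed and $B_1,\dots,B_q\subset X$ be open (repetitions allowed, so $k[B]$ means $B$ listed $k$ times). Then $\sum_i[A_i]\prec\sum_j[B_j]$ means that for each $i$ there is a finite open cover $\{U_{i,k}\}_k$ of $A_i$, elements $g_{i,k}\in G$, and indices $j(i,k)\in\{1,\dots,q\}$ such that $g_{i,k}U_{i,k}\subset B_{j(i,k)}$, and for each $j$ the sets $g_{i,k}U_{i,k}$ over all pairs $(i,k)$ with $j(i,k)=j$ are pairwise disjoint. One writes $A\prec B$ for $[A]\prec[B]$. Comparison: $A\prec B$ whenever $A$ is closed, $B$ is open and $\mu(A)<\mu(B)$ for every $G$-invariant Borel probability measure $\mu$ on $X$. Weak $k$-comparison: $[A]\prec(k+1)[B]$ whenever $A$ is closed, $B$ is open and $\overline{D}(A)<\underline{D}(B)$. *)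

(* Defs.v *)
From HB Require Import structures.
From mathcomp Require Export all_boot all_order all_algebra finmap.
From mathcomp Require Export all_classical all_reals all_analysis.

Set Implicit Arguments.
Unset Strict Implicit.
Unset Printing Implicit Defensive.

Import Order.TTheory GRing.Theory Num.Theory.

Local Open Scope classical_set_scope.
Local Open Scope ring_scope.

(* Amenability in von Neumann's form: a finitely additive left-invariant
   probability measure defined on all subsets of G. *)
Definition amenable (R : realType) (G : groupType) : Prop :=
  exists m : set G -> R,
    [/\ forall A, 0 <= m A,
        m setT = 1,
        forall A B, A `&` B = set0 -> m (A `|` B) = m A + m B
      & forall (g : G) A, m [set (g * h)%g | h in A] = m A].

Definition metrizable (R : realType) (X : topologicalType) : Prop :=
  exists d : X -> X -> R,
    [/\ forall x y, d x y = 0 <-> x = y,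
        forall x y, d x y = d y x,
        forall x y z, d x z <= d x y + d y z
      & forall x, nbhs x =
          filter_from [set r : R | 0 < r] (fun r => [set y | d x y < r])].

(* (K, e)-invariance. [counting] gives +oo on infinite sets, so that K = fset0
   (the empty intersection being G) is covered as well. *)
Definition invariant_shape (R : realType) (G : groupType)
    (K : {fset G}) (e : R) (S : {fset G}) : Prop :=
  (((1 - e) * (#|` S|)%:R)%:E <
   counting (\bigcap_(g in [set` K]) [set (g * h)%g | h in [set` S]]))%E.

Section Actions.
Variables (G : groupType) (X : ptopologicalType) (act : G -> X -> X).

(* Each [act g] is then a homeomorphism, with inverse [act g^-1]. *)
Definition continuous_action : Prop :=
  [/\ forall x, act 1%g x = x,
      forall g h x, act (g * h)%g x = act g (act h x)
    & forall g, continuous (act g)].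

Definition free_action : Prop := forall g x, act g x = x -> g = 1%g.

Definition density_in (R : realType) (A : set X) (F : {fset G}) (x : X) :
    \bar R :=
  ((#|` fset_set (A `&` [set act g x | g in [set` F]])|)%:R
    / (#|` F|)%:R)%:E.

Definition upper_density (R : realType) (A : set X) : \bar R :=
  ereal_inf [set ereal_sup [set density_in R A F x | x in [set: X]]
            | F in [set F : {fset G} | F != fset0]].

Definition lower_density (R : realType) (A : set X) : \bar R :=
  ereal_sup [set ereal_inf [set density_in R A F x | x in [set: X]]
            | F in [set F : {fset G} | F != fset0]].

Definition free_set (L : {fset G}) (U : set X) : Prop :=
  trivIset [set` L] (fun g => act g @` U).

Definition marker_set (U : set X) : Prop :=
  open U /\ \bigcup_(g in [set: G]) (act g @` U) = [set: X].

Definition marker_property : Prop :=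
  forall L : {fset G}, exists U : set X, marker_set U /\ free_set L U.

Definition tower_set (S : {fset G}) (V : set X) : set X :=
  \bigcup_(g in [set` S]) (act g @` V).

Definition tower (S : {fset G}) (V : set X) : Prop := open V /\ free_set S V.

Definition castle (n : nat) (S : 'I_n -> {fset G}) (V : 'I_n -> set X) : Prop :=
  (forall i, tower (S i) (V i)) /\
  trivIset [set: 'I_n] (fun i => tower_set (S i) (V i)).

Definition castle_remainder (n : nat) (S : 'I_n -> {fset G})
    (V : 'I_n -> set X) : set X :=
  ~` \bigcup_(i in [set: 'I_n]) tower_set (S i) (V i).

Definition URP (R : realType) : Prop :=
  forall (K : {fset G}) (e : R), 0 < e ->
    exists (n : nat) (S : 'I_n -> {fset G}) (V : 'I_n -> set X),
      [/\ castle S V,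
          forall i, invariant_shape K e (S i)
        & (upper_density R (castle_remainder S V) < e%:E)%E].

(* The relation sum_(i : I) [A i] < sum_(j : J) [B j]; multiplicities are
   encoded in the index types. The (i, k)-th member of the covers is indexed by
   the pair Tagged k : {i : I & 'I_(m i)}; empty covers (m i = 0) are allowed,
   and are needed when J is empty. *)
Definition subequivalent (I J : finType) (A : I -> set X) (B : J -> set X) :
    Prop :=
  exists (m : I -> nat) (U : {i : I & 'I_(m i)} -> set X)
         (g : {i : I & 'I_(m i)} -> G) (j : {i : I & 'I_(m i)} -> J),
    [/\ forall t, open (U t),
        forall i, A i `<=` \bigcup_(k in [set: 'I_(m i)])
                             U (Tagged (fun i => 'I_(m i)) k),
        forall t, act (g t) @` U t `<=` B (j t)
      & forall j0, trivIset [set t | j t = j0] (fun t => act (g t) @` U t)].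

Definition subequivalent1 (A B : set X) : Prop :=
  subequivalent (fun _ : unit => A) (fun _ : unit => B).

Definition invariant_measure (R : realType)
    (mu : probability (g_sigma_algebraType (@open X)) R) : Prop :=
  forall (g : G) (A : set (g_sigma_algebraType (@open X))),
    measurable A -> mu (act g @` A) = mu A.

Definition comparison (R : realType) : Prop :=
  forall A B : set X, closed A -> open B ->
    (forall mu : probability (g_sigma_algebraType (@open X)) R,
       invariant_measure mu -> (mu A < mu B)%E) ->
    subequivalent1 A B.

Definition weak_comparison (R : realType) (k : nat) : Prop :=
  forall A B : set X, closed A -> open B ->
    (upper_density R A < lower_density R B)%E ->
    subequivalent (fun _ : unit => A) (fun _ : 'I_k.+1 => B).

End Actions.

(* Main.v *)
From HB Require Import structures.
Require Import Defs.
From mathcomp Require Import zify ring lra.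

(* Two tools drive the equivalence.  The first is a topological Hall lemma: in
   a normal space, closed sets A_i and open sets B_j with
   sum 1_{A_i} <= sum 1_{B_j} pointwise satisfy sum [A_i] < sum [B_j] without
   moving any point.  Applied to the base of a tower, it turns counting
   inequalities along the orbit pieces S_i v into subequivalences, whatever the
   dimension of X.  The second is a compactness principle: an inequality that
   holds for all finitely additive invariant means on X holds with a uniform
   gap along all sufficiently invariant finite sets, since otherwise an
   ultralimit of frequencies would be a mean violating it.  Such a mean is
   dominated on closed sets, and dominates on open sets, an invariant Borel
   probability measure, which links densities with the measures in the
   definition of comparison.  For (iv) -> (i), a marker set whose closure
   has small density is placed inside B, the remainder of a castle is moved
   into it, and the rest of A is matched into B inside the towers. *)

Set Implicit Arguments.
Unset Strict Implicit.
Unset Printing Implicit Defensive.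
Import Order.TTheory GRing.Theory Num.Theory.
Import numFieldNormedType.Exports.
Local Open Scope classical_set_scope.
Local Open Scope ring_scope.

(** * The topological Hall lemma *)

(** Means are only finitely additive and live on all subsets of X, because an ultralimit of visit
    frequencies is defined on every set but need not be countably additive. The measure extracted
    from a mean controls it from one side only, closed sets from above and open sets from below.
    This is exactly the pairing of comparison: nu A <= mu A < mu B <= nu B for A closed and B open.
    The same pairing is what makes the Hall lemma hold in every dimension: a sum of indicators of
    closed sets is upper semicontinuous and one of open sets is lower semicontinuous, so a counting
    inequality survives a slight fattening of the closed sets. The gap along invariant finite sets
    says nothing if there are no such sets, so their existence is drawn each time from a castle with
    at least one tower. Infiniteness of G allows large shapes, for which rounding of epsilon |S_i|
    loses little, and large L, for which an L-free set U has small mean since |L| nu U <= 1. *)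

Lemma metrizable_hausdorff (R : realType) (X : topologicalType) :
  metrizable R X -> hausdorff_space X.
Proof.
move=> [d [d0 dC dT dN]] x y xy; apply/d0/eqP/negPn/negP => dne.
have d_ge0 u v : 0 <= d u v.
  have := dT u v u; rewrite (dC v u) (proj2 (d0 u u) erefl); lra.
have dgt0 : 0 < d x y by rewrite lt_def dne d_ge0.
have nb z : nbhs z [set w | d z w < d x y / 2].
  by rewrite dN; exists (d x y / 2) => //=; rewrite divr_gt0.
have [z [/= xz yz]] := xy _ _ (nb x) (nb y).
by have := dT x z y; rewrite (dC z y); lra.
Qed.

Lemma closed_setD (X : topologicalType) (A B : set X) :
  closed A -> open B -> closed (A `\` B).
Proof. by move=> cA oB; apply: closedI => //; exact: open_closedC. Qed.

Lemma open_setD (X : topologicalType) (A B : set X) :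
  open A -> closed B -> open (A `\` B).
Proof. by move=> oA cB; apply: openI => //; exact: closed_openC. Qed.

Lemma normal_sep (X : topologicalType) (A O : set X) : normal_space X ->
  closed A -> open O -> A `<=` O ->
  exists N, [/\ open N, A `<=` N & closure N `<=` O].
Proof.
move=> nX cA oO AO.
have /(nX A cA) [M /set_nbhsP[N [oN AN NM]] MO] : set_nbhs A O.
  by apply/set_nbhsP; exists O; split.
by exists N; split=> //; apply: subset_trans MO; exact: closureS.
Qed.

(** The part of A that only [U i] covers is a closed subset of [U i]. It receives its own
    neighborhood [N], and A minus [N] is left to the remaining sets. *)
Lemma shrink_cover_seq (X : topologicalType) (I : eqType) (s : seq I)
    (U : I -> set X) (A : set X) : normal_space X -> uniq s ->
  (forall i, open (U i)) -> closed A -> (forall x, A x -> exists2 i, i \in s & U i x) ->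
  exists N : I -> set X, [/\ forall i, open (N i),
    forall i, closure (N i) `<=` U i & forall x, A x -> exists2 i, i \in s & N i x].
Proof.
move=> nX + oU; elim: s A => [|i s IH] A /=.
  move=> _ cA Anil; exists (fun=> set0); split=> [i|i|x /Anil[]//].
    exact: open0.
  by rewrite closure0; apply: sub0set.
move=> /andP[iNs us] cA AU.
have [|x|N [oN AN NU]] :=
    @normal_sep X (A `\` \bigcup_(j in [set` s]) U j) (U i) nX _ (oU i).
- by apply: closed_setD => //; exact: bigcup_open.
- case=> Ax nUx; have [j] := AU x Ax; rewrite inE => /orP[/eqP->//|js Uj].
  by case: nUx; exists j.
have [||M [oM MU AM]] := IH (A `\` N) us.
- exact: closed_setD.
- move=> x [Ax Nx]; apply: contrapT => nUx; apply: Nx; apply: AN; split=> //.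
exists (fun j => if j == i then N else M j); split=> [j|j|x Ax].
- by case: eqP.
- by case: eqP => // ->.
- have [Nx|Nx] := pselect (N x).
    by exists i; rewrite ?inE ?eqxx.
  have [|j js Mj] := AM x; first by split.
  exists j; first by rewrite inE js orbT.
  by case: eqP js iNs => // -> ->.
Qed.

Lemma shrink_cover (X : topologicalType) (I : finType) (U : I -> set X)
    (A : set X) : normal_space X ->
  (forall i, open (U i)) -> closed A -> A `<=` \bigcup_i U i ->
  exists N : I -> set X, [/\ forall i, open (N i),
    forall i, closure (N i) `<=` U i & A `<=` \bigcup_i N i].
Proof.
move=> nX oU cA AU.
have [|N [oN NU AN]] :=
    shrink_cover_seq (s := enum I) nX (enum_uniq _) oU cA.
  by move=> x /AU[i _ Ui]; exists i; rewrite ?mem_enum.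
by exists N; split=> // x /AN[i _ Ni]; exists i.
Qed.

Section TopologicalHall.
Variables (X : topologicalType) (nX : normal_space X).

(** The set [O] of points with room for one more set is open: near v no new closed [A i] appears and
    no open [B j] is lost. Normality fits [N] between [A i0] and [O]. The sum runs over a list [s]
    so that a later induction can drop one [B j] at a time. *)
Lemma expand_closed (I J : finType) (s : seq J) (A : I -> set X)
    (B : J -> set X) (i0 : I) :
  (forall i, closed (A i)) -> (forall j, open (B j)) ->
  (forall v, \sum_i (v \in A i) <= \sum_(j <- s) (v \in B j))%N ->
  exists N, [/\ open N, A i0 `<=` N & forall v,
    ((v \in closure N) + \sum_(i | i != i0) (v \in A i) <=
      \sum_(j <- s) (v \in B j))%N].
Proof.
move=> cA oB AB.
pose O := [set v | (1 + \sum_(i | i != i0) (v \in A i) <=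
                      \sum_(j <- s) (v \in B j))%N].
have oO : open O.
  rewrite openE => v /= Ov.
  have nA : \forall w \near v, forall i, ~ A i v -> ~ A i w.
    apply: filter_forall => i; have [Av|nAv] := pselect (A i v).
      by near=> w => /(_ Av).
    have : nbhs v (~` A i).
      by apply: open_nbhs_nbhs; split=> //; exact: closed_openC.
    by apply: filterS => w ? _.
  have nB : \forall w \near v, forall j, B j v -> B j w.
    apply: filter_forall => j; have [Bv|nBv] := pselect (B j v).
      have : nbhs v (B j) by apply: open_nbhs_nbhs.
      by apply: filterS.
    by near=> w => /nBv.
  near=> w; rewrite /O /=; apply: leq_trans (leq_trans Ov _).
    rewrite leq_add2l; apply: leq_sum => i _.
    have nAw : ~ A i v -> ~ A i w by move: (i); near: w.
    have [/set_mem Aw|//] := boolP (w \in A i).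
    by rewrite mem_set//; apply: contrapT => /nAw.
  apply: leq_sum => j _.
  have nBw : B j v -> B j w by move: (j); near: w.
  have [/set_mem Bv|//] := boolP (v \in B j).
  by rewrite mem_set//; exact: nBw.
have [v Av|N [oN AN NO]] := normal_sep nX (cA i0) oO.
  have := AB v; rewrite (bigD1 i0)//= mem_set//.
exists N; split=> // v.
have [/set_mem/NO//|_] := boolP (v \in closure N).
apply: leq_trans (AB v); rewrite add0n [leqRHS](bigD1 i0)//=; exact: leq_addl.
Unshelve. all: by end_near. Qed.

Lemma expand_closed_family (I J : finType) (s : seq J) (A : I -> set X)
    (B : J -> set X) :
  (forall i, closed (A i)) -> (forall j, open (B j)) ->
  (forall v, \sum_i (v \in A i) <= \sum_(j <- s) (v \in B j))%N ->
  exists N : I -> set X, [/\ forall i, open (N i), forall i, A i `<=` N i &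
    forall v, (\sum_i (v \in closure (N i)) <= \sum_(j <- s) (v \in B j))%N].
Proof.
move=> cA oB AB.
(* Only the indices in [l] are fattened so far. The count is kept for the closures, as these are the
   closed sets on which the next step works. *)
suff H (l : seq I) : exists N : I -> set X, [/\ forall i, open (N i),
    forall i, A i `<=` N i &
    forall v, (\sum_i (v \in if i \in l then closure (N i) else A i) <=
                 \sum_(j <- s) (v \in B j))%N].
  have [N [oN AN NB]] := H (enum I); exists N; split=> // v.
  apply: leq_trans (NB v); apply: leq_sum => i _.
  by rewrite (_ : i \in enum I) ?mem_enum.
elim: l => [|i0 l [N [oN AN NB]]].
  by exists (fun=> setT); split=> // i; exact: openT.
pose A' i := if i \in l then closure (N i) else A i.
have cA' i : closed (A' i) by rewrite /A'; case: ifP => // _; exact: closed_closure.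
have [N0 [oN0 AN0 N0B]] := expand_closed i0 cA' oB NB.
exists (fun i => if i == i0 then N0 else N i); split=> [i|i|v].
- by case: eqP.
- case: eqP => [->|//]; apply: subset_trans AN0; rewrite /A'.
  case: ifP => _ v Av //; apply: subset_closure; exact: AN.
apply: leq_trans (N0B v); rewrite (bigD1 i0)//= inE eqxx leq_add2l.
by apply: leq_sum => i /negPf ii0; rewrite inE ii0.
Qed.

(* Induction on the open sets: once the A_i are fattened to closed neighborhoods
   without breaking the count, the first open set is given at each point to the
   least i whose neighborhood contains the point. *)
Lemma ord_topological_hall (p : nat) (J : finType) (s : seq J)
    (A : 'I_p -> set X) (B : J -> set X) :
  (forall i, closed (A i)) -> (forall j, open (B j)) -> uniq s ->
  (forall v, \sum_i (v \in A i) <= \sum_(j <- s) (v \in B j))%N ->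
  exists O : 'I_p -> J -> set X,
    [/\ forall i j, open (O i j), forall i j, O i j `<=` B j,
        forall i v, A i v -> exists2 j, j \in s & O i j v
      & forall j v i i', O i j v -> O i' j v -> i = i'].
Proof.
move=> + oB; elim: s A => [|j0 s IH] A cA /=.
  move=> _ AB; exists (fun _ _ => set0); split=> [i j|i j v []|i v Av|j v i i' []].
    exact: open0.
  by have := AB v; rewrite big_nil (bigD1 i)//= mem_set.
move=> /andP[j0s us] AB.
have [N [oN AN NB]] := expand_closed_family cA oB AB.
pose D (i : 'I_p) := \bigcup_(k in [set k : 'I_p | (k < i)%N]) closure (N k).
have cD i : closed (D i).
  apply: closed_bigcup => [|k _]; first exact: finite_finset.
  exact: closed_closure.
(* Removing the closed set [D i], and not the union of the open N k, keeps [O0 i] open. *)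
pose O0 i := B j0 `&` N i `\` D i.
have oO0 i : open (O0 i).
  by apply: open_setD => //; apply: openI.
pose A' i := A i `\` O0 i.
have cA' i : closed (A' i) by apply: closed_setD.
have A'N i v : A' i v -> closure (N i) v.
  by case=> /AN Nv _; exact: subset_closure.
have A'B v : (\sum_i (v \in A' i) <= \sum_(j <- s) (v \in B j))%N.
  have := NB v; rewrite big_cons.
  have [/set_mem Bv|_] := boolP (v \in B j0); last first.
    rewrite add0n; apply: leq_trans; apply: leq_sum => i _.
    by have [/set_mem/A'N/mem_set ->|] := boolP (v \in A' i).
  have [[i0 Ni0]|noN] := pselect (exists i, closure (N i) v); last first.
    move=> _; rewrite big1 // => i _; apply/eqP; rewrite eqb0; apply/negP => /set_mem/A'N Nv.
    by apply: noN; exists i.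
  pose i1 := [arg min_(i < i0 | v \in closure (N i)) i].
  have [i Ni imin] : exists2 i : 'I_p, closure (N i) v &
      forall k, closure (N k) v -> (i <= k)%N.
    case: (@arg_minnP _ i0 (fun i => v \in closure (N i)) val).
      exact/mem_set.
    move=> i /set_mem Ni imin; exists i => // k Nk; exact/imin/mem_set.
  (* The least i with v in the closure of [N i] pays for [B j0]: it counts among the closures but
     not in [A'], since a point of [A i] lies in [N i], hence here in [O0 i]. *)
  rewrite (bigD1 i)//= mem_set// leq_add2l; apply: leq_trans.
  rewrite (bigD1 i)//= memNset ?add0n.
    apply: leq_sum => k _.
    by have [/set_mem/A'N/mem_set ->|] := boolP (v \in A' k).
  move=> [Av []]; split; first by split=> //; exact: AN.
  by case=> k /= ki /imin; rewrite leqNgt ki.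
have [W [oW WB AW dW]] := IH A' cA' us A'B.
exists (fun i j => if j == j0 then O0 i else if j \in s then W i j else set0).
split=> [i j|i j|i v Av|j v i i'].
- by case: eqP => // _; case: ifP => // _; exact: open0.
- by case: eqP => [-> v [[]]//|_]; case: ifP => _; [exact: WB|exact: sub0set].
- have [Ov|Ov] := pselect (O0 i v); first by exists j0; rewrite ?inE eqxx.
  have [j js Oj] := AW i v (conj Av Ov).
  exists j; first by rewrite inE js orbT.
  by case: eqP js j0s => [-> ->|_ ->].
- case: eqP => [_ [[_ Ni] nDi] [[_ Ni'] nDi']|_].
    have [lt|lt|/val_inj//] := ssrnat.ltngtP (val i) (val i').
      by case: nDi'; exists i => //; exact: subset_closure.
    by case: nDi; exists i' => //; exact: subset_closure.
  by case: ifP => // _; exact: dW.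
Qed.

Lemma topological_hall (I J : finType) (A : I -> set X) (B : J -> set X) :
  (forall i, closed (A i)) -> (forall j, open (B j)) ->
  (forall v, \sum_i (v \in A i) <= \sum_j (v \in B j))%N ->
  exists O : I -> J -> set X,
    [/\ forall i j, open (O i j), forall i j, O i j `<=` B j,
        forall i v, A i v -> exists j, O i j v
      & forall j v i i', O i j v -> O i' j v -> i = i'].
Proof.
move=> cA oB AB.
have [|v|O [oO OB AO dO]] := @ord_topological_hall #|I| J (enum J)
    (fun k => A (enum_val k)) B _ oB (enum_uniq _).
- by move=> k.
- rewrite -(big_enum_val (fun i => (v \in A i) : nat)) big_enum; exact: AB.
exists (fun i => O (enum_rank i)); split=> //.
- by move=> i v; rewrite -{1}(enum_rankK i) => /AO[j _ Oj]; exists j.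
- by move=> j v i i' Oi /(dO _ _ _ _ Oi)/enum_rank_inj.
Qed.

End TopologicalHall.

(** * Finitely additive invariant means *)

Section FinitelyAdditive.
Variables (R : realType) (X : Type) (M : set (set X)) (nu : set X -> R).
Hypotheses (MT : M setT) (MC : forall A, M A -> M (~` A))
  (MI : forall A B, M A -> M B -> M (A `&` B)).
Hypotheses (nu_ge0 : forall A, M A -> 0 <= nu A) (nuT : nu setT = 1)
  (nuU : forall A B, M A -> M B -> A `&` B = set0 -> nu (A `|` B) = nu A + nu B).

Let M0 : M set0. Proof. by rewrite -setCT; exact: MC. Qed.

Let nu0 : nu set0 = 0.
Proof. by have := nuU M0 M0 (setI0 _); rewrite setU0; lra. Qed.

Let nu_split A B : M A -> M B -> nu A = nu (A `&` B) + nu (A `\` B).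
Proof.
move=> MA MB; rewrite -nuU ?setUIDK//; try exact: MI; last by rewrite setDE setIACA setICr setI0.
by rewrite setDE; apply: MI => //; exact: MC.
Qed.

(** Monotonicity of the integral on simple functions: W is cut along [E i], with constant c outside
    and c + a i inside. Once the list is exhausted, a point of W shows c >= 0. *)
Let positive (I : Type) (s : seq I) (a : I -> R) (E : I -> set X) (W : set X)
    (c : R) : (forall i, M (E i)) -> M W ->
  (forall x, W x -> 0 <= c + \sum_(i <- s) a i * (x \in E i)%:R) ->
  0 <= c * nu W + \sum_(i <- s) a i * nu (W `&` E i).
Proof.
move=> ME; elim: s W c => [|i s IH] W c MW.
  move=> W0; rewrite big_nil addr0.
  have [->|/set0P[x Wx]] := eqVneq W set0; first by rewrite nu0 mulr0.
  by have := W0 x Wx; rewrite big_nil addr0 => c0; rewrite mulr_ge0// nu_ge0.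
have MWE : M (W `&` E i) by exact: MI.
have MWD : M (W `\` E i) by rewrite setDE; apply: MI => //; exact: MC.
move=> W0.
have H1 : 0 <= c * nu (W `\` E i) + \sum_(j <- s) a j * nu ((W `\` E i) `&` E j).
  apply: IH => // x [Wx nEx].
  by have := W0 x Wx; rewrite big_cons memNset// mulr0 add0r.
have H2 : 0 <= (c + a i) * nu (W `&` E i) +
               \sum_(j <- s) a j * nu (W `&` E i `&` E j).
  apply: IH => // x [Wx Ex].
  by have := W0 x Wx; rewrite big_cons mem_set// mulr1 addrA.
rewrite big_cons (nu_split MW (ME i)).
have -> : \sum_(j <- s) a j * nu (W `&` E j) =
    \sum_(j <- s) a j * nu (W `&` E i `&` E j) +
    \sum_(j <- s) a j * nu ((W `\` E i) `&` E j).
  rewrite -big_split/=; apply: eq_bigr => j _; rewrite -mulrDr; congr (_ * _).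
  rewrite (nu_split (MI MW (ME j)) (ME i)) setIAC; congr (_ + nu _).
  by rewrite !setDE setIAC.
move: H1 H2; lra.
Qed.

(** The algebra [M] is a parameter so that the lemma serves both means on all subsets and Borel
    probability measures. *)
Lemma mean_le_sum (I J : Type) (s : seq I) (t : seq J) (a : I -> R)
    (b : J -> R) (c : R) (E : I -> set X) (F : J -> set X) :
  (forall i, M (E i)) -> (forall j, M (F j)) ->
  (forall x, \sum_(i <- s) a i * (x \in E i)%:R <=
             c + \sum_(j <- t) b j * (x \in F j)%:R) ->
  \sum_(i <- s) a i * nu (E i) <= c + \sum_(j <- t) b j * nu (F j).
Proof.
move=> ME MF EF.
pose a' (k : I + J) := match k with inl i => - a i | inr j => b j end.
pose E' (k : I + J) := match k with inl i => E i | inr j => F j end.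
have ME' k : M (E' k) by case: k.
have H : 0 <= c * nu setT + \sum_(k <- [seq inl i | i <- s] ++ [seq inr j | j <- t])
    a' k * nu (setT `&` E' k).
  apply: positive => // x _.
  rewrite big_cat !big_map /=; have := EF x.
  by under [in X in _ -> X]eq_bigr do rewrite mulNr; rewrite sumrN; lra.
move: H; rewrite nuT big_cat !big_map /=.
under eq_bigr do rewrite mulNr setTI.
under [X in _ + (_ + X)]eq_bigr do rewrite setTI.
rewrite sumrN; lra.
Qed.

End FinitelyAdditive.

Section InvariantMeans.
Variables (R : realType) (G : groupType) (X : ptopologicalType)
  (act : G -> X -> X).

Definition invariant_mean (nu : set X -> R) : Prop :=
  [/\ forall A, 0 <= nu A, nu setT = 1,
      forall A B, A `&` B = set0 -> nu (A `|` B) = nu A + nu B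
    & forall g A, nu (act g @` A) = nu A].

Section Theory.
Variables (nu : set X -> R) (nuP : invariant_mean nu).

Lemma inv_mean_le_sum (I J : Type) (s : seq I) (t : seq J) (a : I -> R)
    (b : J -> R) (c : R) (E : I -> set X) (F : J -> set X) :
  (forall x, \sum_(i <- s) a i * (x \in E i)%:R <=
             c + \sum_(j <- t) b j * (x \in F j)%:R) ->
  \sum_(i <- s) a i * nu (E i) <= c + \sum_(j <- t) b j * nu (F j).
Proof.
have [nu_ge0 nuT nuU _] := nuP.
by apply: (@mean_le_sum R X setT nu) => // *; exact: nuU.
Qed.

Lemma inv_mean_subadd (I : Type) (s : seq I) (A : set X) (E : I -> set X) :
  (forall x, ((x \in A) <= \sum_(i <- s) (x \in E i))%N) ->
  nu A <= \sum_(i <- s) nu (E i).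
Proof.
move=> AE; have := @inv_mean_le_sum unit I [:: tt] s (fun=> 1) (fun=> 1) 0
  (fun=> A) E.
rewrite !big_seq1 mul1r add0r; under eq_bigr do rewrite mul1r; apply=> x.
rewrite big_seq1 mul1r add0r; under eq_bigr do rewrite mul1r.
by rewrite -natr_sum ler_nat.
Qed.

Lemma inv_mean_superadd (I : Type) (s : seq I) (A : set X) (E : I -> set X) :
  (forall x, (\sum_(i <- s) (x \in E i) <= (x \in A))%N) ->
  \sum_(i <- s) nu (E i) <= nu A.
Proof.
move=> AE; have := @inv_mean_le_sum I unit s [:: tt] (fun=> 1) (fun=> 1) 0
  E (fun=> A).
rewrite !big_seq1 mul1r add0r; under eq_bigr do rewrite mul1r; apply=> x.
rewrite big_seq1 mul1r add0r; under eq_bigr do rewrite mul1r.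
by rewrite -natr_sum ler_nat.
Qed.

Lemma inv_mean_le (A B : set X) : A `<=` B -> nu A <= nu B.
Proof.
move=> AB; have := @inv_mean_subadd _ [:: tt] A (fun=> B).
rewrite big_seq1; apply=> x; rewrite big_seq1.
by have [/set_mem/AB/mem_set ->|] := boolP (x \in A).
Qed.

Lemma inv_mean_act g A : nu (act g @` A) = nu A.
Proof. by case: nuP. Qed.

End Theory.
End InvariantMeans.

(** * Limits of bounded functions along an ultrafilter *)

Section Ultralimit.
Variables (R : realType) (T : Type) (U : set_system T).
Hypothesis UU : UltraFilter U.

Lemma ultralimit_exists (f : T -> R) : (forall t, 0 <= f t <= 1) ->
  exists l : R, f @ U --> l.
Proof.
move=> f01.
have UF : ProperFilter U by exact: ultra_proper.
have [|l [l01 cl]] := @segment_compact R 0 1 (f @ U) _.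
  by apply: (@filterE _ U) => t /=; rewrite in_itv /= f01.
exists l => N Nl; case: (in_ultra_setVsetC (f @^-1` N) UU) => // NC.
by have [y [yN Ny]] := cl (~` N) N NC Nl.
Qed.

Lemma ultralimit : exists L : (T -> R) -> R,
  forall f, (forall t, 0 <= f t <= 1) -> f @ U --> L f.
Proof.
have /choice[L HL] (f : T -> R) :
    exists l : R, (forall t, 0 <= f t <= 1) -> f @ U --> l.
  have [/ultralimit_exists[l fl]|nf] := pselect (forall t, 0 <= f t <= 1).
    by exists l.
  (* A default value that makes [L] total; functions leaving [0,1] are never evaluated. *)
  by exists 0 => /nf.
by exists L.
Qed.

End Ultralimit.

(** * Visit frequencies and Foelner sets *)

Lemma count_split (T : Type) (a b : pred T) (s : seq T) :
  (count (fun x => a x && b x) s + count (fun x => a x && ~~ b x) s = count a s)%N.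
Proof. by elim: s => //= y s <-; case: (a y); case: (b y) => /=; lia. Qed.

Section Counting.
Variables (R : realType) (G : groupType) (X : ptopologicalType)
  (act : G -> X -> X).
Hypothesis actM : forall g h x, act (g * h)%g x = act g (act h x).
Hypothesis act1 : forall x, act 1%g x = x.

Lemma act_inj g : injective (act g).
Proof. by apply: (can_inj (g := act g^-1)) => x; rewrite -actM mulVg act1. Qed.

Lemma mem_act g A x : (act g x \in act g @` A) = (x \in A).
Proof.
apply/idP/idP => /set_mem; last by move=> Ax; apply/mem_set; exists x.
by move=> [y Ay /act_inj <-]; exact/mem_set.
Qed.

Lemma mem_actV g A x : (x \in act g @` A) = (act g^-1 x \in A).
Proof. by rewrite -{1}(act1 x) -(mulgV g) actM mem_act. Qed.

Definition boundary (K F : {fset G}) : nat :=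
  count (fun f => has (fun k => (k * f)%g \notin F) K) F.

Definition folner (K : {fset G}) (e : R) (F : {fset G}) : Prop :=
  F != fset0 /\ (boundary K F)%:R <= e * (#|` F|)%:R.

Definition visits (A : set X) (F : {fset G}) (x : X) : nat :=
  count (fun g => act g x \in A) F.

Lemma visitsE A (F : {fset G}) x : visits A F x = (\sum_(g <- F) (act g x \in A))%N.
Proof.
rewrite /visits -sum1_count big_mkcond; apply: eq_bigr => g _.
by case: (_ \in _).
Qed.

Lemma visits_le_card A (F : {fset G}) x : (visits A F x <= #|` F|)%N.
Proof. by rewrite /visits; exact: count_size. Qed.

Lemma boundary_fsubset (K K' F : {fset G}) : (K `<=` K')%fset ->
  (boundary K F <= boundary K' F)%N.
Proof.
move=> /fsubsetP KK'; apply: sub_count => f /hasP[k kK kf].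
by apply/hasP; exists k => //; exact: KK'.
Qed.

Lemma folner_weaken (K K' F : {fset G}) e e' : (K `<=` K')%fset -> e' <= e ->
  folner K' e' F -> folner K e F.
Proof.
move=> KK' ee' [F0 bF]; split=> //.
apply: le_trans (le_trans bF _); last by rewrite ler_wpM2r.
by rewrite ler_nat boundary_fsubset.
Qed.

Lemma folner_card_gt0 K e F : folner K e F -> 0 < (#|` F|)%:R :> R.
Proof. by case=> F0 _; rewrite ltr0n cardfs_gt0. Qed.

(** Left multiplication by k sends a visit g to A injectively to the visit k g to k A; only visits
    with k g outside F are lost. *)
Lemma visits_act A (K F : {fset G}) x k : k \in K ->
  (visits A F x <= visits (act k @` A) F x + boundary K F)%N.
Proof.
move=> kK.
have <- : count (fun g => (act g x \in A) && ((k * g)%g \in F)) F +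
          count (fun g => (act g x \in A) && ((k * g)%g \notin F)) F = visits A F x.
  exact: count_split.
apply: leq_add; last first.
  by apply: sub_count => g /andP[_ kg]; apply/hasP; exists k.
rewrite /visits -!size_filter.
rewrite -(size_map (fun g => (k * g)%g)); apply: uniq_leq_size.
  rewrite map_inj_uniq ?filter_uniq ?fset_uniq//; exact: mulgI.
move=> h /mapP[g]; rewrite !mem_filter => /andP[/andP[gA kg] gF] ->.
by rewrite kg andbT actM mem_act.
Qed.

(** Counterexamples for (K, e) form a filter base as K grows and e shrinks. Along an ultrafilter
    containing it, visit frequencies converge to an invariant mean with nu A >= nu B + r. The
    conclusion is vacuous where no F qualifies, so each application supplies its own Foelner
    sets. *)
Lemma folner_uniform (A B : set X) (r : R) :
  (forall nu, invariant_mean act nu -> nu A < nu B + r) ->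
  exists (K : {fset G}) (e eta : R), [/\ 0 < e, 0 < eta &
    forall F x, folner K e F ->
    (visits A F x)%:R + eta * (#|` F|)%:R <=
      (visits B F x)%:R + r * (#|` F|)%:R].
Proof.
move=> ABr; apply: contrapT => bad.
(* The second component plays both e and eta, so that a single parameter tends to 0. *)
pose Z (p : {fset G} * R) : set ({fset G} * X) := [set t | folner p.1 p.2 t.1 /\
  (visits B t.1 t.2)%:R + r * (#|` t.1|)%:R <
    (visits A t.1 t.2)%:R + p.2 * (#|` t.1|)%:R].
have Z0 p : 0 < p.2 -> Z p !=set0.
  move=> p0; apply: contrapT => Zp; apply: bad; exists p.1, p.2, p.2; split=> // F x Fp.
  by rewrite leNgt; apply/negP => lt; apply: Zp; exists (F, x).
have FF : ProperFilter (filter_from [set p | 0 < p.2] Z).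
  apply: filter_from_proper; last by move=> p /Z0.
  apply: filter_from_filter; first by exists (fset0, 1) => /=.
  move=> p q /= p0 q0; exists ((p.1 `|` q.1)%fset, Num.min p.2 q.2).
    by rewrite /= lt_min p0.
  move=> [F x] [/= FZ lt]; split; (split;
    first by apply: folner_weaken FZ; rewrite ?fsubsetUl ?fsubsetUr// ge_min lexx ?orbT);
    apply: lt_le_trans lt _; rewrite lerD2l ler_wpM2r// ge_min lexx ?orbT//.
have [U [UU FU]] := ultraFilterLemma FF.
have UF : ProperFilter U by exact: ultra_proper.
have [L LP] := ultralimit R UU.
pose f (E : set X) (t : {fset G} * X) : R := (visits E t.1 t.2)%:R / (#|` t.1|)%:R.
have f01 E t : 0 <= f E t <= 1.
  rewrite divr_ge0//=; have [F0|F0] := posnP #|` t.1|.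
    by rewrite /f F0 invr0 mulr0.
  by rewrite ler_pdivrMr ?ltr0n// mul1r ler_nat visits_le_card.
have fL E := LP _ (f01 E).
have UZ (K : {fset G}) (e : R) : 0 < e -> U (Z (K, e)).
  by move=> e0; apply: FU; exists (K, e).
have L_le (A' B' : set X) (c : R) (K : {fset G}) (e : R) : 0 < e ->
    (forall t, Z (K, e) t -> f A' t <= f B' t + c) -> L (f A') <= L (f B') + c.
  move=> e0 H; rewrite -lerBlDl.
  apply: (@cvgr_to_le _ U UF R (fun t => f A' t - f B' t) _ c).
    by apply: cvgB.
  by apply: filterS (UZ K e e0) => t /H; rewrite lerBlDl.
(* Along Z ([g], e) the boundary costs at most e in frequency, for every e. The reverse inequality
   is this one for g^-1. *)
have Lact_le g E : L (f E) <= L (f (act g @` E)).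
  apply/ler_addgt0Pr => e e0; apply: (L_le _ _ _ [fset g]%fset e e0).
  move=> [F x] [/= FZ _]; have F0 := folner_card_gt0 FZ.
  rewrite -[X in _ + X](mulfK (lt0r_neq0 F0)) /f -mulrDl ler_pM2r ?invr_gt0//=.
  have H : (visits E F x <= visits (act g @` E) F x + boundary [fset g]%fset F)%N.
    by apply: visits_act; rewrite inE.
  by move: H; rewrite -(ler_nat R) natrD; case: FZ => _; lra.
have nuP : invariant_mean act (fun E => L (f E)).
  split=> [E||C D CD|g E].
  - apply: (@cvgr_to_ge _ U UF R (f E) _ 0) => //.
    by apply: (@filterE _ U) => t; case/andP: (f01 E t).
  - have f1 : f setT @ U --> (1 : R).
      apply: cvg_near_cst.
      apply: filterS (UZ fset0 1 ltr01) => -[F x] [/= /folner_card_gt0 F0 _].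
      rewrite /f /= /visits (eq_count (a2 := predT)) ?count_predT ?divff ?gt_eqF//.
      by move=> g; rewrite /= in_setT.
    exact: (cvg_unique (@Rhausdorff R) (fL setT) f1).
  - have fCD : f (C `|` D) @ U --> L (f C) + L (f D).
      have -> : f (C `|` D) = f C \+ f D.
        apply/funext => t; rewrite /f /= -mulrDl -natrD !visitsE -big_split/=.
        congr (_%:R / _); apply: eq_bigr => g _; rewrite in_setU.
        have [/set_mem Cg|//] := boolP (_ \in C); rewrite memNset// => Dg.
        by have : (C `&` D) (act g t.2) by []; rewrite CD.
      exact: cvgD.
    exact: (cvg_unique (@Rhausdorff R) (fL _) fCD).
  - apply/eqP; rewrite eq_le Lact_le andbT.
    have := Lact_le g^-1%g (act g @` E); rewrite image_comp (_ : _ \o _ = id) ?image_id//.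
    by apply/funext => y; rewrite /= -actM mulVg act1.
have := ABr _ nuP; apply/negP; rewrite -leNgt -lerBrDr.
apply/ler_addgt0Pr => e e0; rewrite -addrAC -addrA.
apply: (L_le _ _ _ fset0 e e0) => -[F x] [/= /folner_card_gt0 F0 lt].
rewrite -[X in _ + X](mulfK (lt0r_neq0 F0)) /f -mulrDl ler_pM2r ?invr_gt0//=.
by rewrite mulrBl; move: lt; lra.
Qed.

End Counting.

(** * From invariant means to invariant Borel measures *)

Section Homeomorphisms.
Variables (G : groupType) (X : ptopologicalType) (act : G -> X -> X).
Hypothesis actP : continuous_action act.

Lemma act_image g A : act g @` A = act (g^-1)%g @^-1` A.
Proof.
have [act1 actM _] := actP.
apply/seteqP; split=> [_ [x Ax <-]|x Ax]; first by rewrite /= -actM mulVg act1.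
by exists (act (g^-1)%g x); rewrite // -actM mulgV act1.
Qed.

Lemma act_imageM g h A : act g @` (act h @` A) = act (g * h)%g @` A.
Proof.
have [_ actM _] := actP.
by rewrite image_comp; apply/eq_imagel => x _ /=; rewrite actM.
Qed.

Lemma act_image1 A : act 1%g @` A = A.
Proof.
by have [act1 _ _] := actP; rewrite (@eq_imagel _ _ A _ id) ?image_id.
Qed.

Lemma act_open g A : open A -> open (act g @` A).
Proof.
have [_ _ ca] := actP; move=> oA; rewrite act_image.
by apply: open_comp => // x _; exact: ca.
Qed.

Lemma act_closed g A : closed A -> closed (act g @` A).
Proof.
have [_ _ ca] := actP; move=> cA; rewrite act_image.
by apply: closed_comp => // x _; exact: ca.
Qed.

End Homeomorphisms.

(* The regular Borel measure extracted from a finitely additive mean: inner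
   approximation of open sets by closed ones, then outer approximation of
   arbitrary sets by open ones. *)
Section BorelMeasure.
Variables (R : realType) (G : groupType) (X : ptopologicalType)
  (act : G -> X -> X).
Hypotheses (actP : continuous_action act) (compX : compact [set: X])
  (nX : normal_space X).
Variables (nu : set X -> R) (nuP : invariant_mean act nu).
Local Open Scope ereal_scope.

Definition inner_content (U : set X) : \bar R :=
  ereal_sup [set (nu C)%:E | C in [set C | closed C /\ C `<=` U]].

Definition outer_content (E : set X) : \bar R :=
  ereal_inf [set inner_content U | U in [set U | open U /\ E `<=` U]].

Let nu0 : nu set0 = 0%R.
Proof.
by have [_ _ nuU _] := nuP; have := nuU _ _ (setI0 set0); rewrite setU0; lra.
Qed.

Lemma closed_le_inner C U : closed C -> C `<=` U -> (nu C)%:E <= inner_content U.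
Proof. by move=> cC CU; apply: ereal_sup_ubound; exists C. Qed.

Lemma inner_le U (c : \bar R) :
  (forall C, closed C -> C `<=` U -> (nu C)%:E <= c) -> inner_content U <= c.
Proof. by move=> H; apply: ge_ereal_sup => _ [C [cC CU] <-]; exact: H. Qed.

Lemma inner_ge0 U : 0 <= inner_content U.
Proof. by have := closed_le_inner closed0 (sub0set U); rewrite nu0. Qed.

Lemma inner_le_nu U : inner_content U <= (nu U)%:E.
Proof. by apply: inner_le => C _ CU; rewrite lee_fin (inv_mean_le nuP). Qed.

Lemma le_inner U V : U `<=` V -> inner_content U <= inner_content V.
Proof.
move=> UV; apply: inner_le => C cC CU; apply: closed_le_inner => //.
exact: subset_trans UV.
Qed.

Lemma outer_ge0 E : 0 <= outer_content E.
Proof. by apply: le_ereal_inf_tmp => _ [U _ <-]; exact: inner_ge0. Qed.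

Lemma outer_le_inner E U : open U -> E `<=` U -> outer_content E <= inner_content U.
Proof. by move=> oU EU; apply: ereal_inf_lbound; exists U. Qed.

Lemma le_outer E F : E `<=` F -> outer_content E <= outer_content F.
Proof.
move=> EF; apply: le_ereal_inf_tmp => _ [U [oU FU] <-].
by apply: outer_le_inner => //; exact: subset_trans FU.
Qed.

Lemma outer_open U : open U -> outer_content U = inner_content U.
Proof.
move=> oU; apply/eqP; rewrite eq_le outer_le_inner//=.
by apply: le_ereal_inf_tmp => _ [V [oV UV] <-]; exact: le_inner.
Qed.

Lemma outer_fin_num E : outer_content E \is a fin_num.
Proof.
rewrite ge0_fin_numE ?outer_ge0//; apply: (@le_lt_trans _ _ (nu setT)%:E).
  by apply: le_trans (inner_le_nu setT); apply: outer_le_inner => //; exact: openT.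
by rewrite ltry.
Qed.

(** A closed C in the union is compact, so finitely many [U n] cover it; shrinking this cover to
    closed pieces leaves finite subadditivity of nu. *)
Lemma inner_sigma_subadditive (U : nat -> set X) : (forall n, open (U n)) ->
  inner_content (\bigcup_n U n) <= \sum_(n <oo) inner_content (U n).
Proof.
move=> oU; apply: inner_le => C cC CU.
have cptC : compact C by exact: subclosed_compact compX _.
rewrite compact_cover in cptC.
have [D _ CD] := cptC _ setT U (fun i _ => oU i) CU.
have [x Cx|N [oN NU CN]] :=
    shrink_cover_seq (s := enum_fset D) nX (fset_uniq D) oU cC.
  by have [n nD Un] := CD x Cx; exists n.
apply: le_trans (lee_sum_fset_lim D xpredT _); last by move=> n _; exact: inner_ge0.
apply: (@le_trans _ _ (\sum_(n <- D) (nu (closure (N n)))%:E)).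
  rewrite sumEFin lee_fin; apply: (inv_mean_subadd nuP) => x.
  have [/set_mem/CN[n nD Nn]|//] := boolP (x \in C).
  rewrite (big_rem n)//= mem_set//; exact: subset_closure.
apply: lee_sum => n _; apply: closed_le_inner => //; exact: closed_closure.
Qed.

Lemma outer0 : outer_content set0 = 0.
Proof.
apply/eqP; rewrite eq_le outer_ge0 andbT outer_open; last exact: open0.
by have := inner_le_nu set0; rewrite nu0.
Qed.

Lemma outer_sigma_subadditive : sigma_subadditive outer_content.
Proof.
move=> A; apply/lee_addgt0Pr => e e0.
apply: le_trans (epsilon_trick xpredT (fun n => outer_ge0 (A n)) (ltW e0)).
have /choice[U UP] n : exists U, [/\ open U, A n `<=` U &
    inner_content U <= outer_content (A n) + (e / (2 ^ n.+1)%:R)%:E].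
  have en0 : (0 < e / (2 ^ n.+1)%:R)%R by rewrite divr_gt0// ltr0n expn_gt0.
  have [_ [U [oU AU] <-] lt] := lb_ereal_inf_adherent en0 (outer_fin_num (A n)).
  by exists U; split=> //; exact: ltW.
apply: (@le_trans _ _ (inner_content (\bigcup_n U n))).
  apply: outer_le_inner; first by apply: bigcup_open => n _; have [] := UP n.
  by move=> x [n _ An]; exists n => //; have [_ AU _] := UP n; exact: AU.
apply: le_trans (inner_sigma_subadditive _) _; first by move=> n; have [] := UP n.
apply: lee_nneseries => n *; first exact: inner_ge0.
by have [] := UP n.
Qed.

HB.instance Definition _ := isOuterMeasure.Build R X outer_content outer0
  outer_ge0 le_outer outer_sigma_subadditive.

(** C approximates the intersection of W and U from inside, then D approximates the open set W minus
    C, which contains W minus U. Both are closed, disjoint and inside W, so their means add up to at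
    most the inner content of W. *)
Lemma open_caratheodory U : open U -> outer_content.-caratheodory U.
Proof.
move=> oU; apply: le_caratheodory_measurable => E /=.
apply: le_ereal_inf_tmp => _ [W [oW EW] <-].
apply: (@le_trans _ _ (inner_content (W `&` U) + outer_content (W `\` U))).
  apply: leeD; last by apply: le_outer; exact: setSI.
  by apply: outer_le_inner; [exact: openI|exact: setSI].
rewrite -leeBrDr ?outer_fin_num//; apply: inner_le => C cC CWU.
rewrite leeBrDr ?outer_fin_num// addeC -leeBrDr//.
apply: (@le_trans _ _ (inner_content (W `\` C))).
  apply: outer_le_inner; first exact: open_setD.
  by move=> x [Wx Ux]; split=> // /CWU[].
apply: inner_le => D cD DWC; rewrite leeBrDr// -EFinD.
have [_ _ nuU _] := nuP; rewrite -nuU; last first.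
  by apply/seteqP; split=> // x [/DWC[_ nC] Cx].
apply: closed_le_inner; first exact: closedU.
by move=> x [/DWC[]|/CWU[]].
Qed.

Let borel_caratheodory (A : set (g_sigma_algebraType (@open X))) :
  measurable A -> outer_content.-caratheodory A.
Proof.
suff : <<s (@open X) >> `<=` outer_content.-caratheodory by apply.
apply: smallest_sub; last exact: open_caratheodory.
split.
- exact: caratheodory_measurable_set0.
- by move=> B; rewrite setTD; exact: caratheodory_measurable_setC.
- exact: caratheodory_measurable_bigcup.
Qed.

(** The outer measure retyped on the generated sigma-algebra, where it can carry the measure and
    probability structures. *)
Definition borel_extension : set (g_sigma_algebraType (@open X)) -> \bar R :=
  outer_content.

Let borel_extension0 : borel_extension set0 = 0. Proof. exact: outer0. Qed.

Let borel_extension_ge0 A : 0 <= borel_extension A. Proof. exact: outer_ge0. Qed.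

Let borel_extension_sigma_additive : semi_sigma_additive borel_extension.
Proof.
move=> F mF tF mUF; apply: caratheodory_measure_sigma_additive => //.
  by move=> i; exact: (borel_caratheodory (mF i)).
exact: borel_caratheodory.
Qed.

HB.instance Definition _ := isMeasure.Build _ _ _ borel_extension
  borel_extension0 borel_extension_ge0 borel_extension_sigma_additive.

Let borel_extensionT : borel_extension setT = 1.
Proof.
have [_ nuT _ _] := nuP.
rewrite /borel_extension outer_open; last exact: openT.
rewrite -nuT; apply/eqP; rewrite eq_le inner_le_nu/=.
by apply: closed_le_inner => //; exact: closedT.
Qed.

HB.instance Definition _ :=
  Measure_isProbability.Build _ _ _ borel_extension borel_extensionT.

Lemma inner_act_le g U : inner_content U <= inner_content (act g @` U).
Proof.
apply: inner_le => C cC CU; rewrite -(inv_mean_act nuP g).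
apply: closed_le_inner; last exact: image_subset.
exact: act_closed.
Qed.

Lemma outer_act_le g E : outer_content (act g @` E) <= outer_content E.
Proof.
apply: le_ereal_inf_tmp => _ [U [oU EU] <-].
apply: (@le_trans _ _ (inner_content (act g @` U))).
  by apply: outer_le_inner; [exact: act_open|exact: image_subset].
have := inner_act_le (g^-1)%g (act g @` U).
by rewrite act_imageM// mulVg act_image1.
Qed.

Lemma invariant_borel_measure :
  exists mu : probability (g_sigma_algebraType (@open X)) R,
  [/\ invariant_measure act mu, forall C, closed C -> (nu C)%:E <= mu C &
      forall U, open U -> mu U <= (nu U)%:E].
Proof.
exists borel_extension; split=> [g A _|C cC|U oU].
- apply/eqP; rewrite eq_le outer_act_le/=.
  by have := outer_act_le (g^-1)%g (act g @` A); rewrite act_imageM// mulVg act_image1.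
- by apply: le_ereal_inf_tmp => _ [U [oU CU] <-]; exact: closed_le_inner.
- by rewrite /= /borel_extension outer_open// inner_le_nu.
Qed.

End BorelMeasure.

(** * Invariant shapes *)

Section IndicatorSums.
Variables (X : Type) (I : eqType).

Lemma indicator_le_sum (s : seq I) (A : set X) (E : I -> set X) (x : X) :
  (A x -> exists2 i, i \in s & E i x) ->
  ((x \in A) <= \sum_(i <- s) (x \in E i))%N.
Proof.
move=> AE; have [/set_mem/AE[i si Ei]|//] := boolP (x \in A).
by rewrite (big_rem i)//= mem_set.
Qed.

Lemma sum_le_indicator (s : seq I) (A : set X) (E : I -> set X) (x : X) :
  uniq s -> (forall i, i \in s -> E i `<=` A) ->
  (forall i j, i \in s -> j \in s -> E i x -> E j x -> i = j) ->
  (\sum_(i <- s) (x \in E i) <= (x \in A))%N.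
Proof.
move=> us EA dE; have [[i si Ei]|noE] := pselect (exists2 i, i \in s & E i x).
  rewrite (big_rem i)//= !mem_set//; last exact: EA Ei.
  rewrite big_seq big1 // => j; rewrite mem_rem_uniq// inE => /andP[/eqP ji sj].
  by rewrite memNset// => Ej; apply: ji; exact: dE.
rewrite big_seq big1 // => j sj; rewrite memNset// => Ej.
by apply: noE; exists j.
Qed.

End IndicatorSums.

Section Shapes.
Variables (R : realType) (G : groupType).

Lemma in_shape_core (K S : {fset G}) h :
  (\bigcap_(g in [set` K]) [set (g * x)%g | x in [set` S]]) h <->
  (forall g, g \in K -> (g^-1 * h)%g \in S).
Proof.
split=> H g gK.
  by have [x /= xS <-] := H g gK; rewrite mulgA mulVg mul1g.
by exists (g^-1 * h)%g; [exact: H|rewrite mulgA mulgV mul1g].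
Qed.

Lemma invariant_shape_weaken (K K' S : {fset G}) (e e' : R) :
  (K `<=` K')%fset -> e' <= e -> invariant_shape K' e' S -> invariant_shape K e S.
Proof.
move=> /fsubsetP KK' ee'; rewrite /invariant_shape => lt.
apply: (@le_lt_trans _ _ ((1 - e') * (#|` S|)%:R)%:E).
  by rewrite lee_fin ler_wpM2r// lerB.
apply: lt_le_trans lt _; rewrite /counting.
have sub : \bigcap_(g in [set` K']) [set (g * x)%g | x in [set` S]] `<=`
           \bigcap_(g in [set` K]) [set (g * x)%g | x in [set` S]].
  by move=> h H g gK; apply: H; exact: KK'.
case: asboolP => [fK'|nK']; last first.
  by case: asboolP => // fK; case: nK'; exact: sub_finite_set fK.
case: asboolP => [fK|nK]; last by rewrite leey.
by rewrite lee_fin ler_nat fsubset_leq_card// -fset_set_sub.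
Qed.

(** With 1 in K the intersection lies inside S, so it is finite and the extended-real count becomes
    a count over S. *)
Lemma shape_core_seq (K S : {fset G}) (e : R) : 1%g \in K ->
  invariant_shape K e S ->
  (1 - e) * (#|` S|)%:R <
    (count (fun h => all (fun g => (g^-1 * h)%g \in S) K) S)%:R.
Proof.
move=> K1; rewrite /invariant_shape /counting; set I := \bigcap_(_ in _) _ => H.
have IS : I `<=` [set` S].
  by move=> h /in_shape_core/(_ 1%g K1); rewrite invg1 mul1g.
have fI : finite_set I by apply: sub_finite_set IS _; exact: finite_fset.
move: H; rewrite asboolT// lte_fin => /lt_le_trans; apply.
rewrite ler_nat -size_filter; apply: uniq_leq_size => [|h]; first exact: fset_uniq.
rewrite in_fset_set// => /set_mem Ih; rewrite mem_filter; apply/andP; split.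
  by apply/allP => g gK; exact: (proj1 (in_shape_core K S h)).
exact: IS.
Qed.

(** k f stays in S exactly when f lies in k^-1 S, hence the inverses; adding 1 keeps the
    intersection inside S. *)
Lemma invariant_shape_folner (K S : {fset G}) (e : R) :
  invariant_shape (1%g |` [fset (k^-1)%g | k in K])%fset e S -> folner K e S.
Proof.
move=> /shape_core_seq => /(_ (fset1U1 _ _)) H.
have S0 : S != fset0.
  by apply/eqP => S0; move: H; rewrite S0 cardfs0 mulr0 ltxx.
split=> //; move: H; set c := count _ _ => H.
suff : (boundary K S + c <= #|` S|)%N.
  by rewrite -(ler_nat R) natrD; move: H; lra.
rewrite -(count_predC (fun f => has (fun k => (k * f)%g \notin S) K) S) leq_add2l.
apply: sub_count => h /allP H'; apply/hasPn => k kK /=; rewrite negbK.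
have := H' (k^-1)%g; rewrite invgK; apply.
by apply/fset1UP; right; apply/imfsetP; exists k.
Qed.

(** For e <= 1 some h lies in g S for all g in K, and g |-> g^-1 h embeds K into S. *)
Lemma invariant_shape_card (K S : {fset G}) (e : R) : 1%g \in K -> e <= 1 ->
  invariant_shape K e S -> (#|` K| <= #|` S|)%N.
Proof.
move=> K1 e1 /(shape_core_seq K1) H.
have : (0 < count (fun h => all (fun g => (g^-1 * h)%g \in S) K) S)%N.
  rewrite -(ltr_nat R); apply: le_lt_trans H.
  by rewrite mulr_ge0 ?subr_ge0.
rewrite -has_count => /hasP[h hS /allP hK].
rewrite -(size_map (fun g => (g^-1 * h)%g) K); apply: uniq_leq_size.
  rewrite map_inj_uniq ?fset_uniq// => a b /mulIg; exact: invg_inj.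
by move=> _ /mapP[g gK ->]; exact: hK.
Qed.

(** Putting at least n elements of G into [K'] forces shapes of that size, given the cap e' <= 1.
    The bundle lets later constructions ask a castle for a single invariance condition. *)
Lemma strengthen_shape (K K0 : {fset G}) (e e0 : R) (n : nat) :
  infinite_set [set: G] -> 0 < e -> 0 < e0 ->
  exists (K' : {fset G}) (e' : R), 0 < e' /\
    forall S, invariant_shape K' e' S ->
      [/\ invariant_shape K e S, folner K0 e0 S & (n <= #|` S|)%N].
Proof.
move=> infG he he0; have [B _ nB] := infinite_set_fset n infG.
pose K1 := (1%g |` [fset (k^-1)%g | k in K0])%fset.
exists (K `|` K1 `|` B)%fset, (Num.min (Num.min e e0) 1).
split; first by rewrite !lt_min he he0 ltr01.
move=> S SK; split.
- apply: invariant_shape_weaken SK; first by rewrite -fsetUA fsubsetUl.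
  by rewrite !ge_min lexx.
- apply: invariant_shape_folner; apply: invariant_shape_weaken SK.
    by rewrite fsetUAC fsubsetUr.
  by rewrite !ge_min lexx orbT.
- apply: leq_trans nB _; apply: leq_trans (invariant_shape_card _ _ SK).
  + by apply: fsubset_leq_card; rewrite fsubsetUr.
  + by rewrite !inE eqxx ?orbT.
  + by rewrite !ge_min lexx orbT.
Qed.

End Shapes.

(** * Subequivalence and densities *)

Section Subequivalence.
Variables (G : groupType) (X : ptopologicalType) (act : G -> X -> X).

Lemma subequivalent_intro (J T : finType) (A : set X) (B : J -> set X)
    (U : T -> set X) (g : T -> G) (j : T -> J) :
  (forall t, open (U t)) -> A `<=` \bigcup_t U t ->
  (forall t, act (g t) @` U t `<=` B (j t)) ->
  (forall t t' x, j t = j t' -> (act (g t) @` U t) x ->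
    (act (g t') @` U t') x -> t = t') ->
  subequivalent act (fun _ : unit => A) B.
Proof.
move=> oU AU UB dU; pose h (p : {i : unit & 'I_#|T|}) : T := enum_val (tagged p).
have h_inj : injective h by move=> [[] a] [[] b] /enum_val_inj /= ->.
exists (fun=> #|T|), (U \o h), (g \o h), (j \o h); split=> //=.
- move=> [] x /AU[t _ Ut]; exists (enum_rank t) => //.
  by rewrite /h /= enum_rankK.
- move=> j0 p q /= jp jq [x [px qx]]; apply: h_inj.
  by apply: (dU _ _ x) => //; rewrite jp jq.
Qed.

Lemma subequivalent_elim (J : finType) (A : set X) (B : J -> set X) :
  subequivalent act (fun _ : unit => A) B ->
  exists (T : finType) (U : T -> set X) (g : T -> G) (j : T -> J),
  [/\ forall t, open (U t), A `<=` \bigcup_t U t,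
      forall t, act (g t) @` U t `<=` B (j t) &
      forall t t' x, j t = j t' -> (act (g t) @` U t) x ->
        (act (g t') @` U t') x -> t = t'].
Proof.
move=> [m [U [g [j [oU AU UB dU]]]]].
exists {i : unit & 'I_(m i)}, U, g, j; split=> //.
  move=> x /(AU tt)[k _ Uk]; by exists (Tagged (fun i => 'I_(m i)) k).
by move=> t t' x jt Ux U'x; apply: (dU (j t')) => //=; exists x.
Qed.

Hypothesis actP : continuous_action act.

(* The levels s_l V_i (l < w i) of the towers are moved back to the bases; the
   k.+1 copies of each level use up k.+1 * w i copies of V_i. *)
Lemma subequivalent_levels (k n : nat) (A : set X) (V : 'I_n -> set X)
    (s : 'I_n -> nat -> G) (w q : 'I_n -> nat) :
  (forall i, open (V i)) -> (forall i, k.+1 * w i <= q i)%N ->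
  subequivalent act (fun _ : unit => A) (fun _ : 'I_k.+1 =>
    [set x | exists i l, (l < w i)%N /\ (act (s i l) @` V i) x]) ->
  subequivalent act (fun _ : unit => A) (fun t : {i : 'I_n & 'I_(q i)} => V (tag t)).
Proof.
have [act1 actM _] := actP.
move=> oV wq /subequivalent_elim[T [U [g [j [oU AU UB dU]]]]].
pose J := {i : 'I_n & 'I_(q i)}.
(* Euclidean division by w i reads a copy number as j * w i + l: level l in the j-th of the k.+1
   copies. *)
pose lv (p : J) := ((tagged p : nat) %% w (tag p))%N.
pose W (t : T * J) := if (tagged t.2 %/ w (tag t.2) == j t.1)%N
  then U t.1 `&` act (g t.1)^-1%g @` (act (s (tag t.2) (lv t.2)) @` V (tag t.2))
  else set0.
apply: (@subequivalent_intro J (T * J)%type A _ W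
  (fun t => ((s (tag t.2) (lv t.2))^-1 * g t.1)%g) (fun t => t.2)).
- move=> t; rewrite /W; case: ifP => _; last exact: open0.
  by apply: openI => //; do 2 apply: act_open => //.
- move=> x /AU[t _ Ut].
  have [i [l [lw Vx]]] : [set x | exists i l, (l < w i)%N /\ (act (s i l) @` V i) x] (act (g t) x).
    by apply: (UB t); exists x.
  have lq : (j t * w i + l < q i)%N.
    apply: leq_trans (wq i); have := ltn_ord (j t); nia.
  pose p : J := Tagged (fun i => 'I_(q i)) (Ordinal lq).
  exists (t, p) => //; rewrite /W /= divnMDl ?(leq_ltn_trans _ lw)// divn_small// addn0 eqxx.
  split=> //; exists (act (g t) x); last by rewrite -actM mulVg act1.
  by rewrite /lv /= modnMDl modn_small.
- move=> t _ [x + <-]; rewrite /W; case: ifP => // _ [_ [_ [y Vy <-] <-]].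
  by rewrite -!actM mulgK mulVg act1.
- move=> [t p] [t' p'] x /= -> [y Wy yx] [y' Wy' y'x].
  move: Wy Wy'; rewrite /W /=; case: eqP => //= jt [Ut _]; case: eqP => //= jt' [Ut' _].
  congr (_, _); apply: (dU _ _ (act (g t) y)).
  + by apply/val_inj; rewrite /= -jt -jt'.
  + by exists y.
  + exists y' => //; apply: (act_inj actM act1 (g := (s (tag p') (lv p'))^-1%g)).
    by rewrite -!actM y'x -yx.
Qed.

End Subequivalence.

(** * Densities as bounds on visits, and their effect on means *)

Section Densities.
Variables (R : realType) (G : groupType) (X : ptopologicalType)
  (act : G -> X -> X).
Hypotheses (actP : continuous_action act) (freeA : free_action act).

(** Freeness makes g |-> g x injective, so points of F x in A correspond to elements g of F with g x
    in A. *)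
Lemma density_inE A (F : {fset G}) x :
  density_in act R A F x = ((visits act A F x)%:R / (#|` F|)%:R)%:E.
Proof.
have [act1 actM _] := actP.
have inj_orbit : injective (fun g => act g x).
  move=> g h /(congr1 (act h^-1%g)); rewrite -!actM mulVg act1 => /freeA.
  by move/(congr1 (fun k => h * k)%g); rewrite mulgA mulgV mul1g mulg1.
congr ((_%:R / _)%:E); rewrite /visits -size_filter.
rewrite -(size_map (fun g => act g x)); apply: perm_size; apply: uniq_perm.
- exact: fset_uniq.
- by rewrite map_inj_uniq// filter_uniq// fset_uniq.
have fin : finite_set (A `&` [set act g x | g in [set` F]]).
  by apply: finite_setIr; apply: finite_image; exact: finite_fset.
move=> y; rewrite in_fset_set//; apply/idP/idP.
  move=> /set_mem[Ay [g /= gF gy]]; apply/mapP; exists g => //.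
  by rewrite mem_filter gF andbT gy; exact/mem_set.
move=> /mapP[g]; rewrite mem_filter => /andP[/set_mem Ag gF] ->.
by apply/mem_set; split=> //; exists g.
Qed.

Lemma upper_density_lt A (e : \bar R) : (upper_density act R A < e)%E ->
  exists (F : {fset G}) (r : R), [/\ F != fset0, (r%:E < e)%E &
    forall x, (visits act A F x)%:R <= r * (#|` F|)%:R].
Proof.
move=> /ereal_inf_lt[_ [F /= F0 <-]].
set s := ereal_sup _ => se; exists F.
have F_gt0 : 0 < (#|` F|)%:R :> R by rewrite ltr0n cardfs_gt0.
have ub x : (((visits act A F x)%:R / (#|` F|)%:R)%:E <= s)%E.
  by rewrite -density_inE; apply: ereal_sup_ubound; exists x.
have s1 : (s <= 1)%E.
  apply: ge_ereal_sup => _ [x _ <-]; rewrite density_inE lee_fin.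
  by rewrite ler_pdivrMr// mul1r ler_nat visits_le_card.
(* The supremum is at most 1, and [point] keeps it from being -oo, so it is a real number fit to be
   r. *)
have sfin : s \is a fin_num.
  rewrite fin_numE; apply/andP; split; apply/eqP => sE.
    by have := ub point; rewrite sE.
  by move: s1; rewrite sE.
exists (fine s); rewrite fineK//; split=> // x.
by rewrite -ler_pdivrMr// -lee_fin fineK.
Qed.

Lemma lower_density_gt A (e : \bar R) : (e < lower_density act R A)%E ->
  exists (F : {fset G}) (r : R), [/\ F != fset0, (e < r%:E)%E &
    forall x, r * (#|` F|)%:R <= (visits act A F x)%:R].
Proof.
move=> /ereal_sup_gt[_ [F /= F0 <-]].
set s := ereal_inf _ => se; exists F.
have F_gt0 : 0 < (#|` F|)%:R :> R by rewrite ltr0n cardfs_gt0.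
have lb x : (s <= ((visits act A F x)%:R / (#|` F|)%:R)%:E)%E.
  by rewrite -density_inE; apply: ereal_inf_lbound; exists x.
have s0 : (0 <= s)%E.
  apply: le_ereal_inf_tmp => _ [x _ <-]; rewrite density_inE lee_fin.
  by rewrite divr_ge0.
have sfin : s \is a fin_num.
  rewrite fin_numE; apply/andP; split; apply/eqP => sE.
    by move: s0; rewrite sE.
  by have := lb point; rewrite sE.
exists (fine s); rewrite fineK//; split=> // x.
by rewrite -ler_pdivlMr// -lee_fin fineK.
Qed.

Lemma upper_density_le A (F : {fset G}) (r : R) : F != fset0 ->
  (forall x, (visits act A F x)%:R <= r * (#|` F|)%:R) ->
  (upper_density act R A <= r%:E)%E.
Proof.
move=> F0 H; apply: (@le_trans _ _ (ereal_sup [set density_in act R A F x | x in setT])).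
  by apply: ereal_inf_lbound; exists F.
apply: ge_ereal_sup => _ [x _ <-]; rewrite density_inE lee_fin.
by rewrite ler_pdivrMr ?ltr0n ?cardfs_gt0.
Qed.

Lemma lower_density_ge A (F : {fset G}) (r : R) : F != fset0 ->
  (forall x, r * (#|` F|)%:R <= (visits act A F x)%:R) ->
  (r%:E <= lower_density act R A)%E.
Proof.
move=> F0 H; apply: (@le_trans _ _ (ereal_inf [set density_in act R A F x | x in setT])).
  apply: le_ereal_inf_tmp => _ [x _ <-]; rewrite density_inE lee_fin.
  by rewrite ler_pdivlMr ?ltr0n ?cardfs_gt0.
by apply: ereal_sup_ubound; exists F.
Qed.

Section VisitsMean.
Variables (M : set (set X)) (nu : set X -> R).
Hypotheses (MT : M setT) (MC : forall A, M A -> M (~` A))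
  (MI : forall A B, M A -> M B -> M (A `&` B)).
Hypotheses (nu_ge0 : forall A, M A -> 0 <= nu A) (nuT : nu setT = 1)
  (nuU : forall A B, M A -> M B -> A `&` B = set0 -> nu (A `|` B) = nu A + nu B).
Variables (A : set X) (F : {fset G}) (r : R).
Hypotheses (MA : forall g, M (act g @` A))
  (nuA : forall g, nu (act g @` A) = nu A) (F0 : F != fset0).

Let F_gt0 : 0 < (#|` F|)%:R :> R. Proof. by rewrite ltr0n cardfs_gt0. Qed.

Let sum_nu : \sum_(g <- F) 1 * nu (act g^-1%g @` A) = (#|` F|)%:R * nu A.
Proof.
under eq_bigr do rewrite mul1r nuA.
by rewrite big_const_seq count_predT iter_addr_0 mulr_natl.
Qed.

Let sum_visits x :
  \sum_(g <- F) 1 * (x \in act g^-1%g @` A)%:R = (visits act A F x)%:R :> R.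
Proof.
have [act1 actM _] := actP; rewrite visitsE natr_sum; apply: eq_bigr => g _.
by rewrite mul1r (mem_actV actM act1) invgK.
Qed.

(** The indicators of g^-1 A, g in F, sum to the number of visits, while their means sum to |F| nu
    A. *)
Lemma mean_le_visits :
  (forall x, (visits act A F x)%:R <= r * (#|` F|)%:R) -> nu A <= r.
Proof.
move=> H; rewrite -(ler_pM2l F_gt0) -sum_nu [leRHS]mulrC.
have := @mean_le_sum R X M nu MT MC MI nu_ge0 nuT nuU G unit (enum_fset F) [::]
  (fun=> 1) (fun=> 0) (r * (#|` F|)%:R) (fun g => act g^-1%g @` A) (fun=> setT).
rewrite big_nil addr0; apply=> // x.
by rewrite big_nil addr0 sum_visits.
Qed.

Lemma mean_ge_visits :
  (forall x, r * (#|` F|)%:R <= (visits act A F x)%:R) -> r <= nu A.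
Proof.
move=> H; rewrite -(ler_pM2l F_gt0) -sum_nu [leLHS]mulrC.
have := @mean_le_sum R X M nu MT MC MI nu_ge0 nuT nuU unit G [:: tt] (enum_fset F)
  (fun=> r * (#|` F|)%:R) (fun=> 1) 0 (fun=> setT) (fun g => act g^-1%g @` A).
rewrite big_seq1 nuT mulr1 add0r; apply=> // x.
by rewrite big_seq1 in_setT mulr1 add0r sum_visits.
Qed.

End VisitsMean.

End Densities.

(** * Castles *)

Section MeanEstimates.
Variables (R : realType) (G : groupType) (X : ptopologicalType)
  (act : G -> X -> X).
Hypothesis actP : continuous_action act.
Variables (nu : set X -> R) (nuP : invariant_mean act nu).

Let sum_orbit (L : seq G) U :
  \sum_(l <- L) nu (act l @` U) = (size L)%:R * nu U.
Proof.
under eq_bigr do rewrite (inv_mean_act nuP).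
by rewrite big_const_seq count_predT iter_addr_0 mulr_natl.
Qed.

Lemma inv_meanT : nu setT = 1. Proof. by case: nuP. Qed.

Lemma inv_mean0 : nu set0 = 0.
Proof.
have [_ _ nuU _] := nuP; have := nuU _ _ (setI0 set0); rewrite setU0; lra.
Qed.

Lemma inv_mean_free (L : {fset G}) U : free_set act L U ->
  (#|` L|)%:R * nu U <= 1.
Proof.
move=> fU; rewrite -sum_orbit -inv_meanT; apply: (inv_mean_superadd nuP) => x.
apply: sum_le_indicator => //; first exact: fset_uniq.
by move=> i j iL jL Ux U'x; apply: fU => //; exists x.
Qed.

Lemma inv_mean_cover (L : {fset G}) (A U : set X) :
  (forall x, A x -> exists2 l, l \in L & (act l @` U) x) ->
  nu A <= (#|` L|)%:R * nu U.
Proof.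
move=> LU; rewrite -sum_orbit; apply: (inv_mean_subadd nuP) => x.
by apply: indicator_le_sum => /LU.
Qed.

Lemma inv_mean_subequivalent A B : subequivalent1 act A B -> nu A <= nu B.
Proof.
move=> /subequivalent_elim[T [U [g [j [_ AU UB dU]]]]].
apply: (@le_trans _ _ (\sum_(t <- enum T) nu (U t))).
  apply: (inv_mean_subadd nuP) => x; apply: indicator_le_sum => /AU[t _ Ut].
  by exists t; rewrite ?mem_enum.
under eq_bigr => t _ do rewrite -(inv_mean_act nuP (g t)).
apply: (inv_mean_superadd nuP) => x; apply: sum_le_indicator.
- exact: enum_uniq.
- by move=> t _; exact: (UB t).
- by move=> t t' _ _; apply: dU; case: (j t); case: (j t').
Qed.

End MeanEstimates.

(** The mean m on G is pushed forward along the orbit map of [point]. *)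
Lemma amenable_inv_mean (R : realType) (G : groupType) (X : ptopologicalType)
    (act : G -> X -> X) : continuous_action act -> amenable R G ->
  exists nu : set X -> R, invariant_mean act nu.
Proof.
move=> actP [m [m0 mT mU mI]]; have [act1 actM _] := actP.
exists (fun E => m [set g | E (act g point)]); split=> //.
- move=> A B AB; rewrite -mU//; apply/seteqP; split=> // g [/= Ag Bg].
  by have : (A `&` B) (act g point) by []; rewrite AB.
- move=> g A; rewrite (act_image actP) -[RHS](mI g); congr m.
  apply/seteqP; split=> h /=; rewrite -actM.
    by exists (g^-1 * h)%g; rewrite ?mulgA ?mulgV ?mul1g.
  by move=> [k /= Ak <-]; rewrite mulKg.
Qed.

Section Castles.
Variables (G : groupType) (X : ptopologicalType) (act : G -> X -> X).
Hypothesis actP : continuous_action act.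
Variables (n : nat) (S : 'I_n -> {fset G}) (V : 'I_n -> set X).
Hypothesis SV : castle act S V.

Lemma castle_inj i i' g g' x : g \in S i -> g' \in S i' ->
  (act g @` V i) x -> (act g' @` V i') x -> i = i' /\ g = g'.
Proof.
have [tow dis] := SV; move=> gS gS' gx gx'.
have ii' : i = i'.
  by apply: dis => //; exists x; split; [exists g|exists g'].
subst i'; split=> //; have [_ fr] := tow i.
by apply: fr => //; exists x.
Qed.

Lemma castle_open i : open (V i).
Proof. by have [tow _] := SV; have [] := tow i. Qed.

Lemma castle_level_open i g : open (act g @` V i).
Proof. exact: act_open actP _ _ (castle_open i). Qed.

Lemma castle_cases x : castle_remainder act S V x \/
  exists i g, g \in S i /\ (act g @` V i) x.
Proof.
have [[i _ [g gS gx]]|nx] :=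
  pselect ((\bigcup_(i in [set: 'I_n]) tower_set act (S i) (V i)) x).
  by right; exists i, g.
by left.
Qed.

Lemma castle_remainder_closed : closed (castle_remainder act S V).
Proof.
apply: open_closedC; apply: bigcup_open => i _; apply: bigcup_open => g _.
exact: castle_level_open.
Qed.

Lemma castle_mean (R : realType) (nu : set X -> R) : invariant_mean act nu ->
  1 <= nu (castle_remainder act S V) + \sum_i (#|` S i|)%:R * nu (V i).
Proof.
move=> nuP; have [_ nuT _ _] := nuP.
pose L := [seq (i, g) | i <- enum 'I_n, g <- enum_fset (S i)].
pose E (o : option ('I_n * G)) := if o is Some p then act p.2 @` V p.1
  else castle_remainder act S V.
rewrite -[leLHS]nuT; apply: (@le_trans _ _ (\sum_(o <- None :: map Some L) nu (E o))).
  apply: (inv_mean_subadd nuP) => x; apply: indicator_le_sum => _.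
  have [Rx|[i [g [gS gx]]]] := castle_cases x; first by exists None; rewrite ?inE.
  exists (Some (i, g)) => //; rewrite inE /=; apply: map_f.
  by apply: allpairs_f_dep; rewrite ?mem_enum.
rewrite big_cons big_map lerD2l /L big_allpairs_dep /= big_enum /=.
apply: ler_sum => i _; under eq_bigr do rewrite (inv_mean_act nuP).
by rewrite big_const_seq count_predT iter_addr_0 mulr_natl.
Qed.

End Castles.

(** * Matching inside the towers of a castle *)

Section TowerMatching.
Variables (G : groupType) (X : ptopologicalType) (act : G -> X -> X).
Hypotheses (actP : continuous_action act) (nX : normal_space X).
Variables (n : nat) (S : 'I_n -> {fset G}) (V : 'I_n -> set X).
Hypothesis SV : castle act S V.

(** The Hall lemma is applied on the base, with one open set for each s in [S i]: the points of
    [V i] that s sends into U. The number of these sets containing v is the number of visits of v to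
    U. *)
Let single_tower_matching (T : finType) (C : T -> set X) (U : set X) i :
  (forall t, closed (C t)) -> (forall t, C t `<=` V i) -> open U ->
  (forall v, V i v -> \sum_t (v \in C t) <= visits act U (S i) v)%N ->
  exists O : T -> G -> set X,
  [/\ forall t g, open (O t g), forall t g, O t g `<=` V i,
      forall t g v, O t g v -> g \in S i /\ U (act g v),
      forall t, C t `<=` \bigcup_g O t g
    & forall g t t' v, O t g v -> O t' g v -> t = t'].
Proof.
have [act1 actM cact] := actP.
move=> cC CV oU CU.
have oB (s : S i) : open (V i `&` act (val s) @^-1` U).
  apply: openI; first exact: castle_open SV i.
  by apply: open_comp => // x _; exact: cact.
have [v|O [oO OB CO dO]] := topological_hall nX cC oB.
  have [Vv|nVv] := pselect (V i v); last first.
    by rewrite big1 // => t _; rewrite memNset// => /CV.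
  apply: leq_trans (CU v Vv) _; rewrite visitsE big_seq_fsetE /=.
  apply: leq_sum => s _; have [/set_mem Us|//] := boolP (_ \in U).
  by rewrite mem_set.
exists (fun t g => \bigcup_(s in [set s : S i | val s = g]) O t s); split.
- by move=> t g; apply: bigcup_open.
- by move=> t g v [s _ /OB[]].
- by move=> t g v [s /= <- /OB[_ Uv]]; split=> //; exact: valP.
- by move=> t v /CO[s Os]; exists (val s) => //; exists s.
- by move=> g t t' v [s /= sg Os] [s' /= s'g Os']; apply: (dO s v) => //;
    rewrite (_ : s = s')//; apply: val_inj; exact: etrans sg (esym s'g).
Qed.

(** A piece of A goes down to a base by [h t] and then up to a level by the matching there. Images
    on different levels are disjoint by the castle, those on one level by the matching. As [h t] is
    arbitrary, pieces may come from the remainder as well as from levels. *)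
Lemma tower_matching (T : finType) (A U : set X) (C : T -> set X)
    (i : T -> 'I_n) (h : T -> G) :
  (forall t, closed (C t)) -> (forall t, C t `<=` V (i t)) -> open U ->
  (forall x, A x -> exists t, C t (act (h t) x)) ->
  (forall k v, V k v ->
    \sum_(t | i t == k) (v \in C t) <= visits act U (S k) v)%N ->
  subequivalent1 act A U.
Proof.
have [act1 actM cact] := actP.
move=> cC CV oU AC CU.
have /choice[Q OP] k : exists O : T -> G -> set X,
  [/\ forall t g, open (O t g), forall t g, O t g `<=` V k,
      forall t g v, O t g v -> g \in S k /\ U (act g v),
      forall t, i t = k -> C t `<=` \bigcup_g O t g
    & forall g t t' v, O t g v -> O t' g v -> t = t'].
  have [|||v Vv|O [oO OV OU CO dO]] := @single_tower_matching T
      (fun t => if i t == k then C t else set0) U k.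
  - by move=> t; case: ifP => // _; exact: closed0.
  - by move=> t; case: eqP => [<-//|_ x].
  - exact: oU.
  - apply: leq_trans (CU k v Vv); rewrite [leqRHS]big_mkcond /=.
    by apply: leq_sum => t _; case: ifP => //; rewrite in_set0.
  exists O; split=> // t itk; apply: subset_trans (CO t).
  by rewrite itk eqxx.
pose P := {t : T & S (i t)}.
apply: (@subequivalent_intro G X act unit P A _
  (fun p => act (h (tag p))^-1%g @` Q (i (tag p)) (tag p) (val (tagged p)))
  (fun p => val (tagged p) * h (tag p))%g (fun=> tt)).
- by move=> p; apply: act_open => //; have [] := OP (i (tag p)).
- move=> x /AC[t Ct]; have [_ _ OU CO _] := OP (i t).
  have [g _ Og] := CO t erefl _ Ct; have [gS _] := OU _ _ _ Og.
  exists (Tagged (fun t => S (i t)) [` gS]%fset) => //=.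
  by exists (act (h t) x) => //; rewrite -actM mulVg act1.
- move=> p _ [_ [v Ov <-] <-]; rewrite -actM mulgK.
  by have [_ _ OU _ _] := OP (i (tag p)); have [] := OU _ _ _ Ov.
- move=> [t s] [t' s'] x _ /= [_ [v Ov <-] <-] [_ [v' Ov' <-]].
  rewrite -!actM !mulgK => vv'.
  have [_ OV _ _ dO] := OP (i t); have [_ OV' _ _ _] := OP (i t').
  have [ii' ss'] : i t = i t' /\ val s = val s'.
    apply: (castle_inj SV (x := act (val s) v)); try exact: valP.
      by exists v => //; exact: OV Ov.
    by exists v' => //; exact: OV' Ov'.
  have vE : v = v' by apply: (act_inj actM act1 (g := val s)); rewrite -vv' ss'.
  have tt' : t = t'.
    have Qv' : Q (i t) t' (val s') v' by rewrite ii'.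
    by apply: (dO (val s) t t' v) => //; rewrite ss' vE.
  by subst t'; congr (Tagged _ _); exact: val_inj.
Qed.

End TowerMatching.

(** * The implications between (i), (ii), (iii) and (iv) *)

Section DensityImplications.
Variables (R : realType) (G : groupType) (X : ptopologicalType)
  (act : G -> X -> X).
Hypotheses (infG : infinite_set [set: G]) (compX : compact [set: X])
  (nX : normal_space X) (actP : continuous_action act)
  (freeA : free_action act).

Let act1 x : act 1%g x = x. Proof. by case: actP. Qed.
Let actM g h x : act (g * h)%g x = act g (act h x). Proof. by case: actP. Qed.

Let folner_exists : Prop :=
  forall (K : {fset G}) (e : R), 0 < e -> exists F, folner K e F.

(** The densities leave reals r < r' such that mu A <= r and r' <= mu B for every invariant mu, by
    averaging over one finite set for each bound. *)
Lemma comparison_weak_comparison :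
  comparison act R -> weak_comparison act R 0.
Proof.
move=> comp A B cA oB; set d := lower_density _ _ _ => dens.
have [F [r [F0 rd rA]]] := upper_density_lt actP freeA dens.
have [F' [r' [F'0 rr' rB]]] := lower_density_gt actP freeA rd.
have AB : subequivalent1 act A B.
  apply: comp => // mu muP.
  pose T := g_sigma_algebraType (@open X).
  pose M : set (set X) := @measurable _ T.
  have oM U : open U -> M U by move=> oU; exact: sub_sigma_algebra.
  have MC C : M C -> M (~` C) by exact: (@measurableC _ T).
  have MI C D : M C -> M D -> M (C `&` D) by exact: (@measurableI _ T).
  have MT : M setT by exact: (@measurableT _ T).
  have cM C : closed C -> M C.
    by move=> cC; rewrite -[C]setCK; apply: MC; apply: oM; exact: closed_openC.
  have fin C : M C -> mu C \is a fin_num by move=> MCC; exact: fin_num_measure.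
  pose nu (C : set X) : R := fine (mu C).
  have nu_ge0 C : M C -> 0 <= nu C by move=> _; exact: fine_ge0.
  have nuT : nu setT = 1 by rewrite /nu probability_setT.
  have nuU C D : M C -> M D -> C `&` D = set0 -> nu (C `|` D) = nu C + nu D.
    by move=> MCC MD CD; rewrite /nu measureU// fineD// fin.
  have nuA g : nu (act g @` A) = nu A by rewrite /nu muP//; exact: cM.
  have nuB g : nu (act g @` B) = nu B by rewrite /nu muP//; exact: oM.
  have MA g : M (act g @` A) by apply: cM; exact: act_closed.
  have MB g : M (act g @` B) by apply: oM; exact: act_open.
  have A_r : nu A <= r by exact: (mean_le_visits actP MT MC MI nu_ge0 nuT nuU MA nuA F0 rA).
  have B_r : r' <= nu B by exact: (mean_ge_visits actP MT MC MI nu_ge0 nuT nuU MB nuB F'0 rB).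
  rewrite -[X in (X < _)%E]fineK; last exact: fin (cM _ cA).
  rewrite -[X in (_ < X)%E]fineK; last exact: fin (oM _ oB).
  rewrite lte_fin; apply: le_lt_trans A_r _; apply: lt_le_trans B_r.
  by rewrite lte_fin in rr'.
have [T [U [g [j [oU AU UB dU]]]]] := subequivalent_elim AB.
apply: (@subequivalent_intro G X act 'I_1 T A _ U g (fun=> ord0)) => //.
by move=> t t' x _; apply: dU; case: (j t); case: (j t').
Qed.

Lemma shapes_folner :
  (forall (K : {fset G}) (e : R), 0 < e -> exists S, invariant_shape K e S) ->
  folner_exists.
Proof.
move=> H K e e0; have [S SK] := H (1%g |` [fset (k^-1)%g | k in K])%fset e e0.
by exists S; exact: invariant_shape_folner.
Qed.

Lemma castle_remainder0 (S : 'I_0 -> {fset G}) (V : 'I_0 -> set X) :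
  castle_remainder act S V = setT.
Proof. by rewrite -subTset => x _ [[]]. Qed.

Lemma URP_folner : URP act R -> folner_exists.
Proof.
move=> urp; apply: shapes_folner => K e e0.
(* The cap at 1 excludes the castle without towers, whose remainder X is visited all the time. *)
have m0 : 0 < Num.min e 1 by rewrite lt_min e0 ltr01.
have [[|n] [S [V [SV Sinv dens]]]] := urp K _ m0; last first.
  exists (S ord0); apply: invariant_shape_weaken (Sinv ord0) => //.
  by rewrite ge_min lexx.
have [F [r [F0 re H]]] := upper_density_lt actP freeA dens.
have F_gt0 : 0 < (#|` F|)%:R :> R by rewrite ltr0n cardfs_gt0.
have := H point; rewrite castle_remainder0 /visits (eq_count (a2 := predT)).
  rewrite count_predT ler_pMl//; move: re; rewrite lte_fin lt_min => /andP[_].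
  by rewrite ltNge => /negP.
by move=> g; rewrite /= in_setT.
Qed.

Lemma marker_cover U : marker_set act U ->
  exists T : {fset G}, forall x, exists2 t, t \in T & (act t @` U) x.
Proof.
move=> [oU UX]; have cpt := compX; rewrite compact_cover in cpt.
have [| |T _ TU] := cpt G setT (fun g => act g @` U).
- by move=> g _; exact: act_open.
- by rewrite -UX.
by exists T => x; have [t tT tx] := TU x I; exists t.
Qed.

Lemma weak_comparison_castles (k : nat) :
  URP act R -> weak_comparison act R k ->
  forall (K : {fset G}) (e : R), 0 < e ->
    exists (n : nat) (S : 'I_n -> {fset G}) (V : 'I_n -> set X),
      [/\ castle act S V,
          forall i, invariant_shape K e (S i)
        & subequivalent act
            (fun _ : unit => castle_remainder act S V)
            (fun t : {i : 'I_n & 'I_(Num.truncn (e * (#|` S i|)%:R))} =>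
               V (tag t))].
Proof.
move=> urp wc K e e0.
pose e1 := Num.min e 1; have e1_gt0 : 0 < e1 by rewrite lt_min e0 ltr01.
have e1e : e1 <= e by rewrite ge_min lexx.
have e11 : e1 <= 1 by rewrite ge_min lexx orbT.
pose k1 : R := k.+1%:R; have k1_ge1 : 1 <= k1 by rewrite ler1n.
have k1_gt0 : 0 < k1 by lra.
(* Each tower will offer about the fraction e1 / k1 of its levels. The factor 2 absorbs the
   rounding, which needs |S i| >= 2 k1 / e1. *)
pose c := e1 / (2 * k1).
have cE : c * (2 * k1) = e1 by rewrite /c divfK// mulf_neq0// ?gt_eqF.
have c_gt0 : 0 < c by rewrite divr_gt0// mulr_gt0.
have c_le : c <= 1 / 2 by nra.
have [K' [e' [e'0 strong]]] :=
  strengthen_shape K fset0 (Num.truncn (2 * k1 / e1)).+1 infG e0 ltr01.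
have m0 : 0 < Num.min e' (c / 2) by rewrite lt_min e'0 divr_gt0.
have [n [S [V [SV Sinv dens]]]] := urp K' _ m0.
have Sstrong i : invariant_shape K e (S i) /\
    ((Num.truncn (2 * k1 / e1)).+1 <= #|` S i|)%N.
  have /strong[//] : invariant_shape K' e' (S i).
  by apply: invariant_shape_weaken (Sinv i) => //; rewrite ge_min lexx.
exists n, S, V; split=> //; first by move=> i; case: (Sstrong i).
pose w i := (Num.truncn (e1 * (#|` S i|)%:R) %/ k.+1)%N.
have w_le i : (w i <= #|` S i|)%N.
  apply: leq_trans (leq_div _ _) _; rewrite -(ler_nat R).
  apply: (@le_trans _ _ (e1 * (#|` S i|)%:R)); last by rewrite ler_piMl.
  by rewrite Num.Theory.truncn_le mulr_ge0// ltW.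
have w_ge i : c * (#|` S i|)%:R <= (w i)%:R.
  have [_ Si] := Sstrong i; move: Si; rewrite -(ler_nat R) => Si.
  have Si' : 2 * k1 <= e1 * (#|` S i|)%:R.
    rewrite [leRHS]mulrC -ler_pdivrMr//; apply: le_trans Si.
    exact/ltW/Num.Theory.truncnS_gt.
  have tr : e1 * (#|` S i|)%:R < (Num.truncn (e1 * (#|` S i|)%:R)).+1%:R.
    exact: Num.Theory.truncnS_gt.
  have dv : (Num.truncn (e1 * (#|` S i|)%:R) < (w i).+1 * k.+1)%N.
    exact: ltn_ceil.
  move: tr; have : ((Num.truncn (e1 * (#|` S i|)%:R)).+1%:R <= ((w i).+1 * k.+1)%:R :> R).
    by rewrite ler_nat.
  rewrite natrM -/k1 -(natr1 (w i)) => le1 lt1.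
  by rewrite -(ler_pM2r k1_gt0); move: cE Si' le1 lt1; nra.
pose s i l := nth 1%g (S i) l.
have sS i l : (l < w i)%N -> s i l \in S i.
  by move=> lw; apply: mem_nth; exact: leq_trans lw (w_le i).
pose B := [set x | exists i l, (l < w i)%N /\ (act (s i l) @` V i) x].
apply: (@subequivalent_levels G X act actP k n _ V s w).
- by move=> i; exact: castle_open SV i.
- move=> i; rewrite mulnC; apply: leq_trans (leq_trunc_div _ _) _.
  by apply: Num.Theory.le_truncn; rewrite ler_wpM2r.
apply: wc; first exact: castle_remainder_closed.
  have -> : [set x | exists i l, (l < w i)%N /\ (act (s i l) @` V i) x] =
      \bigcup_i \bigcup_(l in [set l | (l < w i)%N]) (act (s i l) @` V i).
    apply/seteqP; split=> x; first by move=> [i [l [lw Vx]]]; exists i => //; exists l.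
    by move=> [i _ [l lw Vx]]; exists i, l.
  apply: bigcup_open => i _; apply: bigcup_open => l _.
  by apply: act_open => //; exact: castle_open SV i.
rewrite -/B.
have [F0 [r [F00 rc H0]]] := upper_density_lt actP freeA dens.
have rc2 : r < c / 2 by move: rc; rewrite lte_fin lt_min => /andP[].
(* With R the remainder, nu B >= c (1 - nu R) and nu R <= r < c / 2 <= 1 / 4, so nu B > c / 2.
   Comparing with the empty set turns this into a lower density of at least c / 2. *)
have [nu nuP|K1 [e2 [eta [e20 eta0 HB]]]] :=
  @folner_uniform R G X act actM act1 set0 B (- (c / 2)).
  have [nu_ge0 nuT nuU nuA] := nuP.
  rewrite (inv_mean0 nuP).
  have Rr : nu (castle_remainder act S V) <= r.
    by apply: (mean_le_visits (M := setT) actP _ _ _ _ _ _ _ _ F00 H0) => // *;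
      exact: nuU.
  have nuV i : 0 <= nu (V i) by exact: nu_ge0.
  pose L := [seq (i, l) | i <- enum 'I_n, l <- iota 0 (w i)].
  have LB : \sum_(p <- L) nu (act (s p.1 p.2) @` V p.1) <= nu B.
    apply: (inv_mean_superadd nuP) => x; apply: sum_le_indicator.
    + apply: allpairs_uniq_dep.
        exact: enum_uniq.
      by move=> i _; exact: iota_uniq.
      by move=> [i l] [i' l'] _ _ /= [-> ->].
    + move=> _ /allpairsPdep[i [l [_ li ->]]] y /= Vy; exists i, l; split=> //.
      by rewrite mem_iota in li.
    + move=> _ _ /allpairsPdep[i [l [_ li ->]]] /allpairsPdep[i' [l' [_ li' ->]]] /=.
      rewrite !mem_iota !add0n /= in li li' => Vx Vx'.
      have [ii' ss'] := castle_inj SV (sS _ _ li) (sS _ _ li') Vx Vx'.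
      subst i'; congr (_, _); apply/eqP.
      rewrite -(nth_uniq 1%g _ _ (fset_uniq (S i))) ?(leq_trans _ (w_le i))//.
      exact/eqP.
  have LBsum : \sum_(p <- L) nu (act (s p.1 p.2) @` V p.1) = \sum_i (w i)%:R * nu (V i).
    rewrite /L big_allpairs_dep /= big_enum /=; apply: eq_bigr => i _.
    under eq_bigr do rewrite nuA.
    by rewrite big_const_seq count_predT iter_addr_0 size_iota mulr_natl.
  have csum : c * (\sum_i (#|` S i|)%:R * nu (V i)) <= \sum_i (w i)%:R * nu (V i).
    by rewrite mulr_sumr; apply: ler_sum => i _; rewrite mulrA ler_wpM2r.
  have := castle_mean S V nuP; rewrite LBsum in LB; nra.
have [F FK] := URP_folner urp K1 e20.
apply: (@lt_le_trans _ _ (c / 2)%:E).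
  by apply: lt_le_trans dens _; rewrite lee_fin ge_min lexx orbT.
have F_gt0 := folner_card_gt0 FK.
apply: (lower_density_ge actP freeA (F := F)); first by case: FK.
move=> x; have := HB F x FK; rewrite /visits (eq_count (a2 := pred0)) ?count_pred0.
  by have := mulr_gt0 eta0 F_gt0; rewrite mulNr; lra.
by move=> g; rewrite /= in_set0.
Qed.

End DensityImplications.

(** * From (iii) to (iv), and URP from (iv) *)

Section MarkerImplications.
Variables (R : realType) (G : groupType) (X : ptopologicalType)
  (act : G -> X -> X).
Hypotheses (infG : infinite_set [set: G]) (amenG : amenable R G)
  (compX : compact [set: X])
  (nX : normal_space X) (actP : continuous_action act)
  (freeA : free_action act).

Let act1 x : act 1%g x = x. Proof. by case: actP. Qed.
Let actM g h x : act (g * h)%g x = act g (act h x). Proof. by case: actP. Qed.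

Definition base_absorbing_castles : Prop :=
  forall (K : {fset G}) (e : R), 0 < e ->
    exists (n : nat) (S : 'I_n -> {fset G}) (V : 'I_n -> set X),
      [/\ castle act S V,
          forall i, invariant_shape K e (S i)
        & subequivalent act
            (fun _ : unit => castle_remainder act S V)
            (fun t : {i : 'I_n & 'I_(Num.truncn (e * (#|` S i|)%:R))} =>
               V (tag t))].

Definition marker_absorbing_castles : Prop :=
  forall (K : {fset G}) (e : R) (U : set X), 0 < e -> marker_set act U ->
    exists (n : nat) (S : 'I_n -> {fset G}) (V : 'I_n -> set X),
      [/\ castle act S V,
          forall i, invariant_shape K e (S i)
        & subequivalent1 act (castle_remainder act S V) U].

(** Each base is moved to a level t i with L (t i) inside S i, so the L-translates of the union
    consist of distinct levels. Translates cover X because the remainder is itself moved into the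
    bases. *)
Lemma base_absorbing_marker : base_absorbing_castles -> marker_property act.
Proof.
move=> H L.
(* Being below 1 is what counts: the boundary of [S i] must miss some element t. *)
have e0 : 0 < 1 / 2 :> R by lra.
have [K [e [e_gt0 strong]]] := strengthen_shape fset0 L 0 infG e0 e0.
have [n [S [V [SV Sinv /subequivalent_elim[T [U [g [j [_ RU UV _]]]]]]]]] := H K e e_gt0.
have /choice[t tP] i : exists t, t \in S i /\ forall l, l \in L -> (l * t)%g \in S i.
  have [_ [S0 bd] _] := strong _ (Sinv i).
  have : has (predC (fun f => has (fun k => (k * f)%g \notin S i) L)) (S i).
    rewrite has_predC; apply/negP; rewrite all_count => /eqP bdE.
    have : 0 < (#|` S i|)%:R :> R by rewrite ltr0n cardfs_gt0.
    by move: bd; rewrite /boundary bdE; lra.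
  move=> /hasP[f fS /= /hasPn fL]; exists f; split=> // l /fL.
  by rewrite negbK.
exists (\bigcup_i act (t i) @` V i); split; first split.
- apply: bigcup_open => i _; exact: (castle_level_open actP SV).
- rewrite -subTset => x _.
  have base i v h : V i v -> act h v = x ->
      (\bigcup_(g in [set: G]) (act g @` \bigcup_i act (t i) @` V i)) x.
    move=> Vv <-; exists (h * (t i)^-1)%g => //; exists (act (t i) v).
      by exists i => //; exists v.
    by rewrite -actM -mulgA mulVg mulg1.
  have [Rx|[i [h [_ [v Vv hv]]]]] := castle_cases act S V x; last exact: (base i v h Vv hv).
  have [p _ Up] := RU x Rx.
  apply: (base (tag (j p)) (act (g p) x) (g p)^-1%g).
    by apply: (UV p); exists x.
  by rewrite -actM mulVg act1.
- move=> l l' /= lL l'L [x [[_ [i _ [v Vv <-]] <-] [_ [i' _ [v' Vv' <-]]]]].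
  rewrite -!actM => vv'.
  have [ii' tt'] : i = i' /\ (l * t i)%g = (l' * t i')%g.
    apply: (castle_inj SV (x := act (l * t i)%g v)).
    + by have [_] := tP i; exact.
    + by have [_] := tP i'; exact.
    + by exists v.
    + by exists v'.
  by subst i'; move: tt' => /mulIg.
Qed.

Lemma base_absorbing_marker_absorbing :
  base_absorbing_castles -> marker_absorbing_castles.
Proof.
move=> H K e U e0 mU; have [oU _] := mU.
have [T0 T0U] := marker_cover compX actP mU.
have T0_gt0 : 0 < (#|` T0|)%:R :> R.
  have [t tT _] := T0U point; rewrite ltr0n cardfs_gt0.
  by apply/eqP => T00; move: tT; rewrite T00 in_fset0.
(* The T0-translates of U cover X, so every mean gives U at least 1 / |T0| = 2 r; half of this is
   kept as the gap. *)
pose r : R := (2 * (#|` T0|)%:R)^-1.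
have r0 : 0 < r by rewrite invr_gt0 mulr_gt0.
have rE : 2 * (#|` T0|)%:R * r = 1 by rewrite mulfV// gt_eqF// mulr_gt0.
have [nu nuP|K0 [e1 [eta [e10 eta0 HU]]]] :=
  @folner_uniform R G X act actM act1 set0 U (- r).
  have := inv_mean_cover nuP (A := setT) (fun x _ => T0U x).
  rewrite (inv_meanT nuP) (inv_mean0 nuP); move: rE r0 T0_gt0; nra.
have [K' [e' [e'0 strong]]] := strengthen_shape K K0 0 infG e0 e10.
have m0 : 0 < Num.min e' r by rewrite lt_min e'0.
have [n [S [V [SV Sinv]]]] := H K' _ m0; set e2 := Num.min e' r => RV.
have Sstrong i : invariant_shape K e (S i) /\ folner K0 e1 (S i).
  have /strong[//] : invariant_shape K' e' (S i).
  by apply: invariant_shape_weaken (Sinv i) => //; rewrite ge_min lexx.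
exists n, S, V; split=> //; first by move=> i; case: (Sstrong i).
have [T [W [g [j [oW RW WV dW]]]]] := subequivalent_elim RV.
have [N [oN NW RN]] := shrink_cover nX oW (castle_remainder_closed actP SV) RW.
pose C t := act (g t) @` closure (N t).
have CV t : C t `<=` V (tag (j t)).
  by move=> x [y Ny <-]; apply: (WV t); exists y => //; exact: NW.
apply: (@tower_matching G X act actP nX n S V SV T _ U C (fun t => tag (j t)) g) => //.
- by move=> t; apply: act_closed => //; exact: closed_closure.
- move=> x /RN[t _ Nt]; exists t; exists x => //; exact: subset_closure.
move=> k v _.
(* Pieces containing v use distinct copies of V k, by the disjointness in [RV]. There are at most r
   |S k| copies, and v visits U more often than that along S k. *)
pose D := [set t : T | (tag (j t) == k) && (v \in C t)]%SET.
have -> : (\sum_(t | tag (j t) == k) (v \in C t) = #|D|)%N.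
  rewrite -sum1dep_card big_mkcondr; apply: eq_bigr => t _.
  by case: (v \in C t).
have Dq : (#|D| <= Num.truncn (e2 * (#|` S k|)%:R))%N.
  pose q i := Num.truncn (e2 * (#|` S i|)%:R).
  rewrite -(card_in_imset (f := j)); last first.
    move=> t t'; rewrite !inE => /andP[_ /set_mem Ct] /andP[_ /set_mem Ct'] jj.
    apply: (dW t t' v) => //.
      by have [y /NW Wy <-] := Ct; exists y.
    by have [y /NW Wy <-] := Ct'; exists y.
  apply: (@leq_trans #|[set Tagged (fun i => 'I_(q i)) l | l : 'I_(q k)]%SET|).
    apply: subset_leq_card; apply/fintype.subsetP => p /imsetP[t].
    rewrite inE => /andP[/eqP tk _] ->; case: (j t) tk => i l /= ik; subst k.
    by apply/imsetP; exists l.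
  by apply: leq_trans (leq_imset_card _ _) _; rewrite card_ord.
apply: leq_trans Dq _.
have := HU (S k) v (Sstrong k).2.
rewrite /visits (eq_count (a2 := pred0)) ?count_pred0; last by move=> h; rewrite /= in_set0.
move=> HUk; rewrite -(ler_nat R).
apply: (@le_trans _ _ (e2 * (#|` S k|)%:R)).
  by rewrite Num.Theory.truncn_le mulr_ge0// ltW.
have e2r : e2 <= r by rewrite ge_min lexx orbT.
have Sk := folner_card_gt0 (Sstrong k).2.
by move: HUk; have := mulr_gt0 eta0 Sk; have := ler_wpM2r (ltW Sk) e2r; rewrite mulNr; lra.
Qed.

(** Amenability enters here: it provides an invariant mean nu, and |L| >= 2 gives nu U <= 1/2. A
    castle without towers would move all of X into U, against nu X = 1. *)
Lemma marker_absorbing_folner : marker_property act -> marker_absorbing_castles ->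
  forall (K : {fset G}) (e : R), 0 < e -> exists F, folner K e F.
Proof.
move=> mark H; apply: shapes_folner => K e e0.
have [L _ L2] := infinite_set_fset 2 infG.
have [U [mU fU]] := mark L.
have [[|n] [S [V [_ Sinv RU]]]] := H K e U e0 mU; last by exists (S ord0).
have [nu nuP] := amenable_inv_mean actP amenG.
have := inv_mean_subequivalent nuP RU; have := inv_mean_free nuP fU.
rewrite castle_remainder0 (inv_meanT nuP).
have : 2 <= (#|` L|)%:R :> R by rewrite ler_nat.
by move=> h1 h2 h3; exfalso; nra.
Qed.

Lemma marker_absorbing_URP : marker_property act -> marker_absorbing_castles ->
  URP act R.
Proof.
move=> mark H K e e0.
(* |L| > 2 / e makes nu U < e / 2 for every mean, and the remainder has mean at most nu U. *)
have [L _ Ln] := infinite_set_fset (Num.truncn (2 / e)).+1 infG.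
have Le : 2 < (#|` L|)%:R * e.
  rewrite -ltr_pdivrMr//; apply: lt_le_trans (Num.Theory.truncnS_gt _) _.
  by rewrite ler_nat.
have [U [mU fU]] := mark L.
have [n [S [V [SV Sinv RU]]]] := H K e U e0 mU.
exists n, S, V; split=> //.
have [nu nuP|K0 [e1 [eta [e10 eta0 HR]]]] :=
  @folner_uniform R G X act actM act1 (castle_remainder act S V) set0 (e / 2).
  have nu_ge0 : 0 <= nu U by case: nuP.
  have := inv_mean_subequivalent nuP RU; have := inv_mean_free nuP fU.
  by rewrite (inv_mean0 nuP); move=> h1 h2; nra.
have [F FK] := marker_absorbing_folner mark H K0 e10.
have F_gt0 := folner_card_gt0 FK.
apply: (@le_lt_trans _ _ (e / 2)%:E); last by rewrite lte_fin; lra.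
apply: (upper_density_le actP freeA (F := F)); first by case: FK.
move=> x; have := HR F x FK; rewrite [X in _ <= X%:R + _]/visits.
rewrite (eq_count (a2 := pred0)) ?count_pred0; last by move=> h; rewrite /= in_set0.
by have := mulr_gt0 eta0 F_gt0; lra.
Qed.

End MarkerImplications.

(** * Comparison from (iv) *)

Section Comparison.
Variables (R : realType) (G : groupType) (X : ptopologicalType)
  (act : G -> X -> X).
Hypotheses (infG : infinite_set [set: G]) (amenG : amenable R G)
  (compX : compact [set: X])
  (nX : normal_space X) (actP : continuous_action act)
  (freeA : free_action act).

Let act1 x : act 1%g x = x. Proof. by case: actP. Qed.
Let actM g h x : act (g * h)%g x = act g (act h x). Proof. by case: actP. Qed.

(* U is a translate into B of shrunken pieces of an L-free marker set with L
   large; D is the corresponding closed set. *)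
Lemma small_marker_inside (B : set X) (F : {fset G}) (eta : R) :
  0 < eta -> marker_property act -> open B ->
  (forall x, exists2 f, f \in F & B (act f x)) ->
  exists U D : set X, [/\ marker_set act U, U `<=` B, closed D, U `<=` D &
    forall nu : set X -> R, invariant_mean act nu -> nu D < eta].
Proof.
move=> eta0 mark oB FB.
(* D will consist of |F| translates of a subset of an L-free set, so its mean is at most |F| / |L| <
   eta. *)
have [L _ Ln] := infinite_set_fset (Num.truncn ((#|` F|)%:R / eta)).+1 infG.
have Leta : (#|` F|)%:R < (#|` L|)%:R * eta.
  rewrite -ltr_pdivrMr//; apply: lt_le_trans (Num.Theory.truncnS_gt _) _.
  by rewrite ler_nat.
have [U0 [mU0 fU0]] := mark L; have [oU0 _] := mU0.
have [T TU] := marker_cover compX actP mU0.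
have [||N [oN NU XN]] := shrink_cover (I := T) (U := fun t => act (val t) @` U0)
    (A := setT) nX _ closedT.
- by move=> t; apply: act_open.
- by move=> x _; have [t tT tx] := TU x; exists [` tT]%fset.
(* The pieces are shrunk before being pulled back into [U0]: the closure of [U0] need not be L-free,
   whereas the closed set [D1] stays inside [U0]. *)
pose U1 := \bigcup_t (act (val t)^-1%g @` N t).
pose D1 := \bigcup_t (act (val t)^-1%g @` closure (N t)).
have oU1 : open U1 by apply: bigcup_open => t _; exact: act_open.
have U1D1 : U1 `<=` D1.
  move=> x [t _ [y Ny <-]]; exists t => //; exists y => //; exact: subset_closure.
have D1U0 : D1 `<=` U0.
  move=> x [t _ [y /NU[z Uz <-] <-]]; by rewrite -actM mulVg act1.
pose U := B `&` \bigcup_(f in [set` F]) (act f @` U1).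
pose D := \bigcup_(f in [set` F]) (act f @` D1).
exists U, D; split=> //.
- split.
    by apply: openI => //; apply: bigcup_open => f _; exact: act_open.
  rewrite -subTset => x _; have [t _ Nt] := XN x I.
  pose z := act (val t)^-1%g x; have [f fF Bf] := FB z.
  exists (val t * f^-1)%g => //; exists (act f z).
    by split=> //; exists f => //; exists z => //; exists t => //; exists x.
  by rewrite -actM -mulgA mulVg mulg1 /z -actM mulgV act1.
- by move=> x [].
- apply: closed_bigcup => [|f _]; first exact: finite_fset.
  apply: act_closed => //; apply: closed_bigcup => [|t _]; first exact: finite_finset.
  by apply: act_closed => //; exact: closed_closure.
- move=> x [_ [f fF [y U1y <-]]]; exists f => //; exists y => //; exact: U1D1.
move=> nu nuP; have nu_ge0 A : 0 <= nu A by case: nuP.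
have DF : nu D <= (#|` F|)%:R * nu D1.
  by apply: (inv_mean_cover nuP) => x [f fF Dx]; exists f.
have D1U : nu D1 <= nu U0 by exact: (inv_mean_le nuP).
have := inv_mean_free nuP fU0.
have : 0 <= (#|` F|)%:R :> R by [].
have := nu_ge0 U0; move: Leta D1U DF; move: (nu D) (nu D1) (nu U0) => d d1 u.
move: (#|` F|%:R) (#|` L|%:R) => f l lt1 le1 le2 u0 f0 le3.
have : d <= f * u by nra.
have [->|u_gt0] : u = 0 \/ 0 < u by move: u0; rewrite le_eqVlt => /orP[/eqP->|]; [left|right].
  by rewrite mulr0; lra.
have : f * u < l * eta * u by rewrite ltr_pM2r.
by nra.
Qed.

(** A is covered by the levels, which are open and disjoint, so its part in one level is what is
    left after removing all the others. *)
Lemma castle_level_closed n (S : 'I_n -> {fset G}) (V : 'I_n -> set X)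
    (A : set X) i g : castle act S V -> closed A ->
  A `&` castle_remainder act S V = set0 -> g \in S i ->
  closed (A `&` act g @` V i).
Proof.
move=> SV cA AR gS.
have -> : A `&` act g @` V i = A `\` \bigcup_(p in [set p : 'I_n * G |
    p.2 \in S p.1 /\ p <> (i, g)]) (act p.2 @` V p.1).
  apply/seteqP; split=> x [Ax].
    move=> gx; split=> // -[[i' g'] /= [g'S ne] g'x]; apply: ne.
    by have [-> ->] := castle_inj SV gS g'S gx g'x.
  move=> nx; split=> //; have [Rx|[i' [g' [g'S g'x]]]] := castle_cases act S V x.
    by have : (A `&` castle_remainder act S V) x by []; rewrite AR.
  have [[<- <-]//|ne] := pselect ((i', g') = (i, g)).
  by case: nx; exists (i', g').
apply: closed_setD => //; apply: bigcup_open => p _; exact: (castle_level_open actP SV).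
Qed.

Lemma marker_absorbing_comparison : marker_property act ->
  marker_absorbing_castles R act -> comparison act R.
Proof.
move=> mark H A B cA oB AB.
have [nu nuP|K1 [e1 [eta [e10 eta0 HAB]]]] :=
  @folner_uniform R G X act actM act1 A B 0.
  have [mu [muP muC muU]] := invariant_borel_measure actP compX nX nuP.
  rewrite addr0 -lte_fin; apply: le_lt_trans (muC A cA) _.
  by apply: lt_le_trans (AB mu muP) _; exact: muU.
have [F1 F1K] := marker_absorbing_folner infG amenG actP mark H K1 e10.
have FB x : exists2 f, f \in F1 & B (act f x).
  have : (0 < visits act B F1 x)%N.
    rewrite -(ltr_nat R); have := HAB F1 x F1K.
    have := mulr_gt0 eta0 (folner_card_gt0 F1K).
    by have : 0 <= (visits act A F1 x)%:R :> R by []; rewrite mul0r; lra.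
  by rewrite -has_count => /hasP[f fF /set_mem Bf]; exists f.
(* D is made smaller than the gap eta between A and B, so B minus D still receives at least as many
   visits as A along invariant shapes. *)
have [U [D [mU UB cD UD nuD]]] := small_marker_inside eta0 mark oB FB.
have [nu nuP|K2 [e2 [eta2 [e20 eta20 HD]]]] :=
  @folner_uniform R G X act actM act1 D set0 eta.
  by rewrite (inv_mean0 nuP) add0r; exact: nuD.
have m0 : 0 < Num.min e1 e2 by rewrite lt_min e10.
have [K [e [e0 strong]]] := strengthen_shape fset0 (K1 `|` K2)%fset 0 infG ltr01 m0.
have [n [S [V [SV Sinv RU]]]] := H K e U e0 mU.
have count i x : (visits act A (S i) x <= visits act (B `\` D) (S i) x)%N.
  have [_ SK _] := strong _ (Sinv i).
  have Si := folner_card_gt0 SK.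
  have SK1 : folner K1 e1 (S i).
    by apply: folner_weaken SK; rewrite ?fsubsetUl// ge_min lexx.
  have SK2 : folner K2 e2 (S i).
    by apply: folner_weaken SK; rewrite ?fsubsetUr// ge_min lexx orbT.
  have h1 := HAB _ x SK1; have h2 := HD _ x SK2.
  have h3 : visits act set0 (S i) x = 0%N.
    rewrite /visits (eq_count (a2 := pred0)) ?count_pred0//.
    by move=> h; rewrite /= in_set0.
  have h4 : (visits act B (S i) x <= visits act (B `\` D) (S i) x + visits act D (S i) x)%N.
    rewrite !visitsE -big_split/=; apply: leq_sum => g _.
    have [/set_mem Bg|//] := boolP (_ \in B).
    have [//|/negP nDg] := boolP (act g x \in D); first by rewrite addn1.
    by rewrite mem_set//; split=> // /mem_set.
  rewrite -(ler_nat R); move: h4; rewrite -(ler_nat R) natrD.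
  move: h1 h2; rewrite h3; have := mulr_gt0 eta20 Si; lra.
have [T [W [g [j [oW RW WU dW]]]]] := subequivalent_elim RU.
(* Removing the open sets that carry the remainder leaves a closed set inside the levels. *)
pose A1 := A `\` \bigcup_t W t.
have cA1 : closed A1 by apply: closed_setD => //; exact: bigcup_open.
have A1R : A1 `&` castle_remainder act S V = set0.
  by apply/seteqP; split=> // x [[_ nW] /RW].
have A1B : subequivalent1 act A1 (B `\` D).
  pose P := {i : 'I_n & S i}.
  pose C (p : P) := act (val (tagged p))^-1%g @`
    (A1 `&` act (val (tagged p)) @` V (tag p)).
  apply: (@tower_matching G X act actP nX n S V SV P A1 _ C (fun p => tag p)
    (fun p => (val (tagged p))^-1%g)).
  - move=> p; apply: act_closed => //; apply: (castle_level_closed SV cA1 A1R).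
    exact: valP.
  - by move=> p x [_ [_ [v Vv <-]] <-]; rewrite -actM mulVg act1.
  - exact: open_setD.
  - move=> x A1x; have [Rx|[i [h [hS hx]]]] := castle_cases act S V x.
      by have : (A1 `&` castle_remainder act S V) x by []; rewrite A1R.
    by exists (Tagged (fun i => S i) [` hS]%fset); exists x.
  - move=> k v _; apply: leq_trans (count k v).
    pose Q i (s : S i) := (v \in C (Tagged (fun i => S i) s)) : nat.
    rewrite (_ : (\sum_(p : P | tag p == k) (v \in C p) = \sum_(s : S k) Q k s)%N).
      rewrite visitsE big_seq_fsetE /=; apply: leq_sum => s _; rewrite /Q.
      have [/set_mem[y [[Ay _] _] <-]|//] := boolP (v \in _).
      by rewrite -actM mulgV act1 mem_set.
    transitivity (\sum_(i | i == k) \sum_(s : S i) Q i s)%N; last by rewrite big_pred1_eq.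
    rewrite (sig_big_dep _ _ (fun i s => Q i s)) /=.
    by apply: eq_big => [p|[i s] _ //]; rewrite andbT.
have [T' [W' [g' [j' [oW' AW' WB' dW']]]]] := subequivalent_elim A1B.
(* The two families have disjoint targets: U lies in D, the other target is B minus D. *)
apply: (@subequivalent_intro G X act unit (T + T')%type A _
  (fun t => match t with inl t => W t | inr t => W' t end)
  (fun t => match t with inl t => g t | inr t => g' t end) (fun=> tt)).
- by case.
- move=> x Ax; have [[t _ Wt]|nW] := pselect ((\bigcup_t W t) x); first by exists (inl t).
  by have [t _ W't] := AW' x (conj Ax nW); exists (inr t).
- case=> t x; first by move=> /WU /UB.
  by move=> /WB'[].
- case=> t [] t' x _ Wx Wx'.
  + by congr inl; apply: (dW _ _ x) => //; case: (j t); case: (j t').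
  + by have /UD := WU _ _ Wx; have [_] := WB' _ _ Wx'.
  + by have /UD := WU _ _ Wx'; have [_] := WB' _ _ Wx.
  + by congr inr; apply: (dW' _ _ x) => //; case: (j' t); case: (j' t').
Qed.

End Comparison.

Theorem theorem3p20 (R : realType) (G : groupType) (X : ptopologicalType)
    (act : G -> X -> X)
    (countG : countable [set: G]) (infG : infinite_set [set: G])
    (amenG : amenable R G)
    (compX : compact [set: X]) (metrX : metrizable R X)
    (actP : continuous_action act) (freeA : free_action act) :
  [<->
    (* (i) *)
    URP act R /\ comparison act R;
    (* (ii) *)
    URP act R /\ (exists k : nat, weak_comparison act R k);
    (* (iii) *)
    forall (K : {fset G}) (e : R), 0 < e ->
      exists (n : nat) (S : 'I_n -> {fset G}) (V : 'I_n -> set X),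
        [/\ castle act S V,
            forall i, invariant_shape K e (S i)
          & subequivalent act
              (fun _ : unit => castle_remainder act S V)
              (fun t : {i : 'I_n & 'I_(Num.truncn (e * (#|` S i|)%:R))} =>
                 V (tag t))];
    (* (iv) *)
    marker_property act /\
    forall (K : {fset G}) (e : R) (U : set X), 0 < e -> marker_set act U ->
      exists (n : nat) (S : 'I_n -> {fset G}) (V : 'I_n -> set X),
        [/\ castle act S V,
            forall i, invariant_shape K e (S i)
          & subequivalent1 act (castle_remainder act S V) U]
  ].
Proof.
have nX : normal_space X.
  exact: compact_normal (metrizable_hausdorff metrX) compX.
split; [|split; [|split]].
- by move=> [urp cmp]; split=> //; exists 0%N; exact: comparison_weak_comparison.
- by move=> [urp [k wc]]; exact: weak_comparison_castles wc.
- move=> H; split; first exact: base_absorbing_marker H.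
  exact: base_absorbing_marker_absorbing H.
- move=> [mark H]; split; first exact: marker_absorbing_URP.
  exact: marker_absorbing_comparison.
Qed.
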